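(* Let $f(\mathbf{x})=\frac1n\sum_{i=1}^nf_i(\mathbf{x})$ (or $f(\mathbf{x})=\mathrm{E}_\xi[f(\mathbf{x};\xi)]$, writing $f_i(\mathbf{x})=f(\mathbf{x};\xi_i)$) on $\mathbb{R}^d$, where every $f_i$ is twice differentiable, has $L_1$-Lipschitz gradient and has $L_2$-Lipschitz Hessian (in spectral norm), $L_1,L_2>0$, and is not necessarily convex. Let $\mathbf{x}_0\in\mathbb{R}^d$ satisfy $f(\mathbf{x}_0)-f(\mathbf{x}_* )\le\Delta<\infty$, where $\mathbf{x}_*$ is a global minimizer of $f$. Let $\delta\in(0,1)$, $\epsilon_1>0$, and $\epsilon_2=\epsilon_1^\alpha$ with $\alpha\in(0,1]$. Suppose that for any $\delta'\in(0,1)$ and $\mathbf{x}\in\mathbb{R}^d$ there exist $\epsilon_3\le\epsilon_2/24$ and $\epsilon_4\le\min\bigl(\frac1{2\sqrt2}\epsilon_1,\frac{\epsilon_2^2}{24L_2}\bigr)$ such that with probability at least $1-\delta'$ the sub-sampled Hessian $H(\mathbf{x})$ and gradient $\mathbf{g}(\mathbf{x})$ satisfy $$\|H(\mathbf{x})-\nabla^2f(\mathbf{x})\|_2\le\epsilon_3,\qquad\|\mathbf{g}(\mathbf{x})-\nabla f(\mathbf{x})\|\le\epsilon_4.$$ Then with probability at least $1-\delta$ the algorithm SNCG$(\mathbf{x}_0,\epsilon_1,\alpha,\delta)$ (defined in the context) terminates at some iteration $j_*$ with $$j_*\le1+\max\left(\frac{48L_2^2}{\epsilon_2^3},\frac{8L_1}{\epsilon_1^2}\right)\Delta,$$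 and upon termination it holds that $\|\nabla f(\mathbf{x}_{j_*})\|\le2\epsilon_1$ and $\lambda_{\min}(\nabla^2f(\mathbf{x}_{j_*}))\ge-2\epsilon_2$ with probability at least $1-3\delta$. Furthermore, the $j$-th iteration requires time at most $$\widetilde O\left(T_h^1|\mathcal S_2|+T_h^1|\mathcal S_2|^{3/4}\frac{\sqrt{L_1}}{\max(\epsilon_2,\|\mathbf{g}(\mathbf{x}_j)\|^\alpha)^{1/2}}+|\mathcal S_1|T_g^1\right).$$
   Context: $\|\cdot\|$ is the Euclidean norm, $\|\cdot\|_2$ the spectral norm, $\lambda_{\min}$ the smallest eigenvalue; $\mathrm{sign}(t)=1$ if $t\ge0$ and $-1$ otherwise. $T_g^1$ is the time of computing one $\nabla f_i(\mathbf{x})$, $T_h^1$ that of one product $\nabla^2f_i(\mathbf{x})\mathbf{u}$. $\widetilde O$ suppresses factors logarithmic in $d$, the inverse failure probability and the inverse accuracies. Sub-sampling: $\mathcal S_1,\mathcal S_2$ are random index sets with elements drawn uniformly from $\{1,\dots,n\}$ (or i.i.d. from the distribution of $\xi$), drawn afresh at each iteration, and $\mathbf{g}(\mathbf{x})=\frac1{|\mathcal S_1|}\sum_{i\in\mathcal S_1}\nabla f_i(\mathbf{x})$, $H(\mathbf{x})=\frac1{|\mathcal S_2|}\sum_{i\in\mathcal S_2}\nabla^2f_i(\mathbf{x})$. Randomized algorithm $\mathcal A$ (approximate PCA): given $H=\frac1m\sum_{i=1}^mH_i$ with symmetric $H_i$, $\|H_i\|_2\le L_1$, $\varepsilon>0$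 and $\delta\in(0,1)$, using fresh randomness it returns a unit $\mathbf{v}$ such that with probability at least $1-\delta$, $\lambda_{\min}(H)\ge\mathbf{v}^\top H\mathbf{v}-\varepsilon$, in time $\widetilde O(T_h^1\max\{m,m^{3/4}\sqrt{L_1/\varepsilon}\})$. Stochastic NCG step, $(\mathbf{x}^+,\mathbf{v})=\text{NCG-S}(\mathbf{x},\varepsilon,\delta,\epsilon_2)$: (1) compute $\mathbf{g}(\mathbf{x})$ and $H(\mathbf{x})$; (2) use $\mathcal A$ to find a unit $\mathbf{v}$ with $\lambda_{\min}(H(\mathbf{x}))\ge\mathbf{v}^\top H(\mathbf{x})\mathbf{v}-\varepsilon$ with probability at least $1-\delta$; (3) if $-\frac{\epsilon_2^2}{2L_2^2}\mathbf{v}^\top H(\mathbf{x})\mathbf{v}-\frac{11\epsilon_2^3}{48L_2^2}>\frac{\|\mathbf{g}(\mathbf{x})\|^2}{4L_1}-\frac{\epsilon_1^2}{8L_1}$, set $\mathbf{x}^+=\mathbf{x}-\frac{\epsilon_2}{L_2}\mathrm{sign}(\mathbf{v}^\top\mathbf{g}(\mathbf{x}))\mathbf{v}$; otherwise set $\mathbf{x}^+=\mathbf{x}-\frac1{L_1}\mathbf{g}(\mathbf{x})$; (4) return $(\mathbf{x}^+,\mathbf{v})$. Algorithm SNCG$(\mathbf{x}_0,\epsilon_1,\alpha,\delta)$: set $\mathbf{x}_1=\mathbf{x}_0$, $\epsilon_2=\epsilon_1^\alpha$, $\delta'=\delta/\bigl(1+\max(\frac{48L_2^2}{\epsilon_2^3},\frac{8L_1}{\epsilon_1^2})\Delta\bigr)$.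 For $j=1,2,\dots$: let $\mathbf{g}(\mathbf{x}_j)$ be the sub-sampled gradient (the same one used inside the step); $(\mathbf{x}_{j+1},\mathbf{v}_j)=\text{NCG-S}(\mathbf{x}_j,\max(\epsilon_2,\|\mathbf{g}(\mathbf{x}_j)\|^\alpha)/2,\delta',\epsilon_2)$; if $\mathbf{v}_j^\top H(\mathbf{x}_j)\mathbf{v}_j>-\epsilon_2/2$ and $\|\mathbf{g}(\mathbf{x}_j)\|\le\epsilon_1$, terminate and return $\mathbf{x}_j$ (then $j_*=j$). The sampling accuracy property is used with this $\delta'$ at each iteration. *)

(* Defs.v *)
From HB Require Import structures.
From mathcomp Require Import all_boot all_order all_algebra.
From mathcomp Require Import all_classical all_reals all_analysis.

Set Implicit Arguments.
Unset Strict Implicit.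
Unset Printing Implicit Defensive.

Import Order.TTheory GRing.Theory Num.Theory.
Import numFieldNormedType.Exports.

Local Open Scope classical_set_scope.
Local Open Scope ring_scope.

(* Points of R^d are row vectors.  The library norm `|x| on 'rV[R]_d is the sup
   norm, so the Euclidean norm is defined here; derivatives do not depend on
   the choice. *)
Definition dot (R : realType) (d : nat) (u v : 'rV[R]_d) : R := (u *m v^T) 0 0.

Definition norm2 (R : realType) (d : nat) (u : 'rV[R]_d) : R :=
  Num.sqrt (dot u u).

Definition quad (R : realType) (d : nat) (M : 'M[R]_d) (v : 'rV[R]_d) : R :=
  (v *m M *m v^T) 0 0.

(* v *m M^T is the row form of the column M v^T. *)
Definition spectral_norm (R : realType) (d : nat) (M : 'M[R]_d) : R :=
  sup [set norm2 (v *m M^T) | v in [set v : 'rV[R]_d | norm2 v = 1]].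

(* Only meaningful for matrices with a real eigenvalue; it is applied to
   symmetric matrices of positive size. *)
Definition lambda_min (R : realType) (d : nat) (M : 'M[R]_d) : R :=
  inf [set a : R | eigenvalue M a].

Definition grad (R : realType) (d : nat) (f : 'rV[R]_d -> R) (x : 'rV[R]_d) :
    'rV[R]_d :=
  \row_(i < d) 'D_(delta_mx 0 i) f x.

Definition hess (R : realType) (d : nat) (f : 'rV[R]_d -> R) (x : 'rV[R]_d) :
    'M[R]_d :=
  'J (grad f) x.

Definition twice_differentiable (R : realType) (d : nat)
    (f : 'rV[R]_d -> R) : Prop :=
  (forall x, differentiable f x) /\ (forall x, differentiable (grad f) x).

Definition smooth_component (R : realType) (d : nat) (L1 L2 : R)
    (f : 'rV[R]_d -> R) : Prop :=
  [/\ twice_differentiable f,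
      forall x y, norm2 (grad f x - grad f y) <= L1 * norm2 (x - y) &
      forall x y, spectral_norm (hess f x - hess f y) <= L2 * norm2 (x - y)].

(* A measure takes unspecified values on non-measurable sets, hence the
   measurable subset; for a measurable E this is p <= P E. *)
Definition with_prob_ge (R : realType) (dO : measure_display)
    (Omega : measurableType dO) (P : probability Omega R) (p : R)
    (E : set Omega) : Prop :=
  exists A : set Omega, [/\ measurable A, A `<=` E & (p%:E <= P A)%E].

(* Mutual independence of a sequence.  Taking B i = setT for the unwanted
   indices gives the product rule for every finite subfamily. *)
Definition mutually_independent (R : realType) (dO dT : measure_display)
    (Omega : measurableType dO) (T : measurableType dT)
    (P : probability Omega R) (X : nat -> Omega -> T) : Prop :=
  forall (n : nat) (B : 'I_n -> set T), (forall i, measurable (B i)) ->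
    P [set w | forall i : 'I_n, B i (X i w)] =
    (\prod_(i < n) P (X i @^-1` B i))%E.

(* The base of the polylogarithmic factors hidden by soft-O, for dimension d,
   failure probability p and accuracies accs; it is at least 1, and 1 + e^-1
   replaces e^-1 so that large accuracies do not give negative logarithms. *)
Definition log_factor (R : realType) (d : nat) (p : R) (accs : seq R) : R :=
  1 + ln d%:R + ln p^-1 + \sum_(e <- accs) ln (1 + e^-1).

Definition mean_mx (R : realType) (d m : nat) (H : 'I_m -> 'M[R]_d) : 'M[R]_d :=
  m%:R^-1 *: \sum_(i < m) H i.

Definition pca_input (R : realType) (d m : nat) (L : R) (H : 'I_m -> 'M[R]_d)
    (eps p : R) : Prop :=
  [/\ (0 < d)%N, (0 < m)%N, 0 < L,
      forall i, (H i)^T = H i /\ spectral_norm (H i) <= L &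
      0 < eps /\ 0 < p < 1].

(* A randomized algorithm for approximate PCA, as a deterministic map of its
   input and of a random seed of law pca_law.
   pca_time Th L H eps p z is the running time when one product of some H i
   with a vector takes time Th.  pca_fast has constants C, k that serve for all
   inputs at once.  pca_measurable is joint Borel measurability in the matrix
   entries, the accuracy and the seed, phrased so as not to need a sigma-algebra
   on matrices. *)
Record approx_pca (R : realType) := ApproxPCA {
  pca_disp : measure_display;
  pca_seed : measurableType pca_disp;
  pca_law : probability pca_seed R;
  pca_run : forall d m : nat,
    R -> ('I_m -> 'M[R]_d) -> R -> R -> pca_seed -> 'rV[R]_d;
  pca_time : forall d m : nat,
    R -> R -> ('I_m -> 'M[R]_d) -> R -> R -> pca_seed -> R;
  pca_measurable : forall (d m : nat) (L p : R)
    (dT : measure_display) (T : measurableType dT)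
    (H : T -> 'I_m -> 'M[R]_d) (eps : T -> R) (z : T -> pca_seed),
    (forall i a b, measurable_fun setT (fun t => H t i a b)) ->
    measurable_fun setT eps -> measurable_fun setT z ->
    forall b, measurable_fun setT
      (fun t => pca_run L (H t) (eps t) p (z t) 0 b);
  pca_unit : forall (d m : nat) (L : R) (H : 'I_m -> 'M[R]_d) (eps p : R) z,
    pca_input L H eps p -> norm2 (pca_run L H eps p z) = 1;
  pca_accurate : forall (d m : nat) (L : R) (H : 'I_m -> 'M[R]_d) (eps p : R),
    pca_input L H eps p ->
    with_prob_ge pca_law (1 - p)
      [set z | lambda_min (mean_mx H) >=
               quad (mean_mx H) (pca_run L H eps p z) - eps];
  pca_fast : exists (C : R) (k : nat),
    forall (d m : nat) (Th L : R) (H : 'I_m -> 'M[R]_d) (eps p : R) z,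
    0 < Th -> pca_input L H eps p ->
    pca_time Th L H eps p z <=
      C * log_factor d p [:: eps] ^+ k *
      (Th * Num.max m%:R (m%:R `^ (3 / 4) * Num.sqrt (L / eps)))
}.

(* The pair of samples (S1, S2) of one iteration; m1 = |S1|, m2 = |S2|. *)
Notation sample Xi m1 m2 := ((m1.-tuple Xi) * (m2.-tuple Xi))%type.

(* nu p is the law of the samples (S1, S2) used for the failure probability p;
   their sizes may depend on p, and S1, S2 need not be independent.  In the
   finite sum, Xi is identified with the discrete space {1,...,n.+1} and each
   drawn element is uniform; nothing is required of the joint law of the
   elements, so drawing with or without replacement is covered.  In the
   expectation, the elements of each sample are i.i.d. of law Q. *)
Variant stochastic_objective (R : realType) (d : nat) (dX : measure_display)
    (Xi : measurableType dX) (F : Xi -> 'rV[R]_d -> R) (f : 'rV[R]_d -> R)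
    (m1 m2 : R -> nat)
    (nu : forall p : R, probability (sample Xi (m1 p) (m2 p)) R) : Prop :=
| FiniteSum (n : nat) (index : 'I_n.+1 -> Xi) of
    bijective index &
    (forall A : set Xi, measurable A) &
    (forall x, f x = n.+1%:R^-1 * \sum_(i < n.+1) F (index i) x) &
    (forall p, 0 < p < 1 -> forall k,
       (forall i, nu p [set S | tnth S.1 i = index k] = (n.+1%:R^-1)%:E) /\
       (forall i, nu p [set S | tnth S.2 i = index k] = (n.+1%:R^-1)%:E))
| Expectation (Q : probability Xi R) of
    (forall x, Q.-integrable setT (fun xi => (F xi x)%:E)) &
    (forall x, f x = \int[Q]_xi F xi x) &
    (forall p, 0 < p < 1 ->
       (forall B : 'I_(m1 p) -> set Xi, (forall i, measurable (B i)) ->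
          nu p [set S | forall i, B i (tnth S.1 i)] =
          (\prod_(i < m1 p) Q (B i))%E) /\
       (forall B : 'I_(m2 p) -> set Xi, (forall i, measurable (B i)) ->
          nu p [set S | forall i, B i (tnth S.2 i)] =
          (\prod_(i < m2 p) Q (B i))%E)).

Definition sub_grad (R : realType) (d m : nat) (Xi : Type)
    (F : Xi -> 'rV[R]_d -> R) (S : m.-tuple Xi) (x : 'rV[R]_d) : 'rV[R]_d :=
  m%:R^-1 *: \sum_(i < m) grad (F (tnth S i)) x.

Definition sample_hess (R : realType) (d m : nat) (Xi : Type)
    (F : Xi -> 'rV[R]_d -> R) (S : m.-tuple Xi) (x : 'rV[R]_d) :
    'I_m -> 'M[R]_d :=
  fun i => hess (F (tnth S i)) x.

Definition sub_hess (R : realType) (d m : nat) (Xi : Type)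
    (F : Xi -> 'rV[R]_d -> R) (S : m.-tuple Xi) (x : 'rV[R]_d) : 'M[R]_d :=
  mean_mx (sample_hess F S x).

Definition sampling_accurate (R : realType) (d : nat) (dX : measure_display)
    (Xi : measurableType dX) (F : Xi -> 'rV[R]_d -> R) (f : 'rV[R]_d -> R)
    (L2 eps1 eps2 : R) (m1 m2 : nat)
    (nu : probability (sample Xi m1 m2) R) (p : R) (x : 'rV[R]_d) : Prop :=
  exists eps3 eps4 : R,
    [/\ eps3 <= eps2 / 24,
        eps4 <= Num.min ((2 * Num.sqrt 2)^-1 * eps1) (eps2 ^+ 2 / (24 * L2)) &
        with_prob_ge nu (1 - p)
          [set S | spectral_norm (sub_hess F S.2 x - hess f x) <= eps3 /\
                   norm2 (sub_grad F S.1 x - grad f x) <= eps4]].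

Definition sign (R : realType) (t : R) : R := if 0 <= t then 1 else -1.

(* The randomness of one iteration: the samples and the seed of the PCA. *)
Notation draw A Xi m1 m2 := (sample Xi m1 m2 * pca_seed A)%type.

Section Algorithm.

Context (R : realType) (A : approx_pca R) (d : nat) (dX : measure_display)
  (Xi : measurableType dX) (F : Xi -> 'rV[R]_d -> R) (m1 m2 : nat)
  (L1 L2 eps1 : R).

Definition ncg_s (x : 'rV[R]_d) (eps p eps2 : R) (w : draw A Xi m1 m2) :
    'rV[R]_d * 'rV[R]_d :=
  let g := sub_grad F w.1.1 x in
  let H := sub_hess F w.1.2 x in
  let v := pca_run L1 (sample_hess F w.1.2 x) eps p w.2 in
  let x' :=
    if - (eps2 ^+ 2 / (2 * L2 ^+ 2)) * quad H v
         - 11 * eps2 ^+ 3 / (48 * L2 ^+ 2)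
       > norm2 g ^+ 2 / (4 * L1) - eps1 ^+ 2 / (8 * L1)
    then x - (eps2 / L2 * sign (dot v g)) *: v
    else x - L1^-1 *: g in
  (x', v).

Context (alpha p : R) (x0 : 'rV[R]_d).

Definition sncg_eps2 : R := eps1 `^ alpha.

Definition sncg_pca_accuracy (x : 'rV[R]_d) (w : draw A Xi m1 m2) : R :=
  Num.max sncg_eps2 (norm2 (sub_grad F w.1.1 x) `^ alpha) / 2.

Definition sncg_step (x : 'rV[R]_d) (w : draw A Xi m1 m2) :
    'rV[R]_d * 'rV[R]_d :=
  ncg_s x (sncg_pca_accuracy x w) p sncg_eps2 w.

(* Iterations are counted from 0 here: draws k is the randomness of iteration
   j = k + 1 and sncg_iterate draws k is x_(k + 1).  The sequence is continued
   formally after termination. *)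
Fixpoint sncg_iterate (draws : nat -> draw A Xi m1 m2) (k : nat) : 'rV[R]_d :=
  if k is k'.+1 then (sncg_step (sncg_iterate draws k') (draws k')).1 else x0.

Definition sncg_stops (draws : nat -> draw A Xi m1 m2) (k : nat) : Prop :=
  let x := sncg_iterate draws k in
  quad (sub_hess F (draws k).1.2 x) (sncg_step x (draws k)).2
    > - (sncg_eps2 / 2) /\
  norm2 (sub_grad F (draws k).1.1 x) <= eps1.

Definition sncg_terminates_at (draws : nat -> draw A Xi m1 m2) (k : nat) :
    Prop :=
  sncg_stops draws k /\ forall i, (i < k)%N -> ~ sncg_stops draws i.

(* The gradients of the sample S1, the PCA, and the product H(x) v needed for
   v^T H(x) v; vector arithmetic is not counted. *)
Definition sncg_iteration_time (Tg Th : R) (draws : nat -> draw A Xi m1 m2)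
    (k : nat) : R :=
  let x := sncg_iterate draws k in
  m1%:R * Tg
  + pca_time Th L1 (sample_hess F (draws k).1.2 x)
      (sncg_pca_accuracy x (draws k)) p (draws k).2
  + m2%:R * Th.

End Algorithm.

Definition sncg_rate (R : realType) (L1 L2 eps1 eps2 : R) : R :=
  Num.max (48 * L2 ^+ 2 / eps2 ^+ 3) (8 * L1 / eps1 ^+ 2).

Definition sncg_step_failure (R : realType) (L1 L2 eps1 eps2 Delta delta : R) :
    R :=
  delta / (1 + sncg_rate L1 L2 eps1 eps2 * Delta).

(* The randomness is drawn afresh at each iteration: in a draw the seed is
   independent of the samples, and the draws are independent of each other. *)
Definition fresh_draws (R : realType) (A : approx_pca R)
    (dX : measure_display) (Xi : measurableType dX) (m1 m2 : nat)
    (nu : probability (sample Xi m1 m2) R)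
    (dO : measure_display) (Omega : measurableType dO)
    (P : probability Omega R) (X : nat -> Omega -> draw A Xi m1 m2) : Prop :=
  [/\ forall k, measurable_fun setT (X k),
      forall k B, measurable B ->
        P (X k @^-1` B) = (nu \x pca_law A)%E B &
      mutually_independent P X].

(* Main.v *)
Require Import Defs.
From HB Require Import structures.
From mathcomp Require Import all_boot all_order all_algebra.
From mathcomp Require Import all_classical all_reals all_analysis.
From mathcomp Require Import measurable_realfun ring lra.

Set Implicit Arguments.
Unset Strict Implicit.
Unset Printing Implicit Defensive.

Import Order.TTheory GRing.Theory Num.Theory.
Import numFieldNormedType.Exports.

Local Open Scope classical_set_scope.
Local Open Scope ring_scope.

(** The proof combines a deterministic descent argument with a union bound.

Call an iteration accurate if its sampled gradient and Hessian are within the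
tolerances allowed by the sampling assumption.  By Taylor expansion, at an
accurate iteration each of the two candidate steps decreases [f] by at least
the quantity that the algorithm compares: the curvature step by the left-hand
side of the test, the gradient step by the right-hand side.  The algorithm takes
the larger one, and if it does not stop, the larger one is at least
[rate^-1] ([sncg_step_descent]).  As [f] can only decrease by [Delta] in total,
accuracy of the first [K := floor N] iterations forces a stop among them
([terminates_within]).  Each of them is inaccurate with probability at most
[p = delta / N], so the failure probability is at most [K * p <= delta].

The accuracy of the eigenvector enters at the stop: there it bounds the smallest
eigenvalue of the sampled Hessian from below, and the sampling errors carry the
bounds over to [f] ([termination_guarantee]).  Asking for accurate eigenvectors
at the first [K] iterations costs another [delta], so the second statement fails
with probability at most [2 * delta].

Three points need work.
- [f] inherits the smoothness of its components ([smooth_objective]).  For a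
  finite sum and for an expectation alike, the Taylor remainders of the
  components are bounded uniformly, so they can be averaged, and the averaged
  bounds identify the derivatives of [f].
- The guarantees on a draw are given at fixed points, while the iterates are
  random.  The iterate of index [k] is a function of the first [k] draws,
  which are independent of the next one, so Fubini's theorem transfers the
  guarantees ([prob_ge_past_present]).  This requires the good events to be
  jointly measurable in the point and the draw.  Gradients and Hessians are
  measurable in the sample and Lipschitz in the point
  ([measurable_lipschitz_comp]), and bounds on spectral norms and eigenvalues
  are countable intersections of conditions on rational directions
  ([measurable_quad_ge0]).
- Smallest eigenvalues are minima of quadratic forms on the sphere
  ([lambda_min_attained]), and Hessians are symmetric ([hess_sym]), so that they
  are legitimate inputs of the eigenvector routine.

The running time bound is a computation: the accuracy requested from the
eigenvector routine is at least [eps2 / 2], which changes the logarithmic factor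
and the square root by constants only ([iteration_time_le]). *)

(** * Euclidean geometry and symmetric matrices *)

Section EuclideanSpace.
Context {R : realType} {d : nat}.
Implicit Types (u v w : 'rV[R]_d) (M N : 'M[R]_d) (a c : R).

Lemma dotE u v : dot u v = \sum_i u 0 i * v 0 i.
Proof. by rewrite /dot mxE; apply: eq_bigr => i _; rewrite mxE. Qed.

Lemma dotC u v : dot u v = dot v u.
Proof. by rewrite !dotE; apply: eq_bigr => i _; rewrite mulrC. Qed.

Lemma dotDl u v w : dot (u + v) w = dot u w + dot v w.
Proof. by rewrite /dot mulmxDl mxE. Qed.

Lemma dotZl a u v : dot (a *: u) v = a * dot u v.
Proof. by rewrite /dot -scalemxAl mxE. Qed.

Lemma dotNl u v : dot (- u) v = - dot u v.
Proof. by rewrite -scaleN1r dotZl mulN1r. Qed.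

Lemma dotBl u v w : dot (u - v) w = dot u w - dot v w.
Proof. by rewrite dotDl dotNl. Qed.

Lemma dotDr u v w : dot u (v + w) = dot u v + dot u w.
Proof. by rewrite dotC dotDl !(dotC u). Qed.

Lemma dotZr a u v : dot u (a *: v) = a * dot u v.
Proof. by rewrite dotC dotZl dotC. Qed.

Lemma dotNr u v : dot u (- v) = - dot u v.
Proof. by rewrite dotC dotNl dotC. Qed.

Lemma dotBr u v w : dot u (v - w) = dot u v - dot u w.
Proof. by rewrite dotDr dotNr. Qed.

Lemma dot0l u : dot 0 u = 0.
Proof. by rewrite -(scale0r 0) dotZl mul0r. Qed.

Lemma dot_delta u i : dot u (delta_mx 0 i) = u 0 i.
Proof.
rewrite dotE (bigD1 i)//= mxE !eqxx mulr1 big1 ?addr0// => j ji.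
by rewrite mxE (negbTE ji) andbF mulr0.
Qed.

Lemma dot_ge0 u : 0 <= dot u u.
Proof. by rewrite dotE sumr_ge0// => i _; rewrite -expr2 sqr_ge0. Qed.

Lemma norm2_ge0 u : 0 <= norm2 u.
Proof. exact: sqrtr_ge0. Qed.

Lemma sqr_norm2 u : norm2 u ^+ 2 = dot u u.
Proof. by rewrite sqr_sqrtr// dot_ge0. Qed.

Lemma normr_coord_le_norm2 u i : `|u 0 i| <= norm2 u.
Proof.
rewrite -ler_sqr ?nnegrE ?norm2_ge0// sqr_norm2 real_normK ?num_real// dotE.
rewrite (bigD1 i)//= -expr2 lerDl sumr_ge0// => j _.
by rewrite -expr2 sqr_ge0.
Qed.

Lemma norm2_eq0 u : (norm2 u == 0) = (u == 0).
Proof.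
apply/eqP/eqP => [u0|->]; last by rewrite /norm2 dot0l sqrtr0.
apply/rowP => i; rewrite mxE; apply/eqP; rewrite -normr_le0 -u0.
exact: normr_coord_le_norm2.
Qed.

Lemma norm2_gt0 u : (0 < norm2 u) = (u != 0).
Proof. by rewrite lt0r norm2_eq0 norm2_ge0 andbT. Qed.

Lemma norm2Z a u : norm2 (a *: u) = `|a| * norm2 u.
Proof. by rewrite /norm2 dotZl dotZr mulrA -expr2 sqrtrM ?sqr_ge0// sqrtr_sqr. Qed.

Lemma norm2N u : norm2 (- u) = norm2 u.
Proof. by rewrite -scaleN1r norm2Z normrN1 mul1r. Qed.

Lemma norm2_distC u v : norm2 (u - v) = norm2 (v - u).
Proof. by rewrite -norm2N opprB. Qed.

Lemma norm2_delta (i : 'I_d) : norm2 (delta_mx 0 i : 'rV[R]_d) = 1.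
Proof. by rewrite /norm2 dot_delta mxE !eqxx sqrtr1. Qed.

Lemma cauchy_schwarz u v : `|dot u v| <= norm2 u * norm2 v.
Proof.
have [->|v0] := eqVneq v 0.
  by rewrite dotC dot0l normr0 mulr_ge0// norm2_ge0.
rewrite -ler_sqr ?nnegrE ?mulr_ge0 ?norm2_ge0//.
rewrite exprMn !sqr_norm2 real_normK ?num_real//.
have vv : 0 < dot v v by rewrite -sqr_norm2 exprn_gt0// norm2_gt0.
have := dot_ge0 (dot v v *: u - dot u v *: v).
rewrite dotBl !dotBr !dotZl !dotZr (dotC v u) => h.
rewrite -(ler_pM2l vv); nra.
Qed.

Lemma dot_le_norm2 u v : dot u v <= norm2 u * norm2 v.
Proof. exact: le_trans (ler_norm _) (cauchy_schwarz _ _). Qed.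

Lemma norm2_triangle u v : norm2 (u + v) <= norm2 u + norm2 v.
Proof.
rewrite -ler_sqr ?nnegrE ?addr_ge0 ?norm2_ge0//.
rewrite sqr_norm2 dotDl !dotDr sqrrD !sqr_norm2 (dotC v u).
have := dot_le_norm2 u v; lra.
Qed.

Lemma norm2_le_dot u c : 0 <= c ->
  (forall v, dot u v <= c * norm2 v) -> norm2 u <= c.
Proof.
move=> c0 /(_ u); rewrite -sqr_norm2 expr2; have [->|u0] := eqVneq u 0.
  by move=> _; rewrite (eqP (_ : norm2 0 == 0)) ?norm2_eq0.
by rewrite ler_pM2r ?norm2_gt0.
Qed.

Lemma normr_le_norm2 u : `|u| <= norm2 u.
Proof.
rewrite [`|u|]mx_normrE; apply: bigmax_le => [|[i j] _]/=; first exact: norm2_ge0.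
by rewrite ord1 normr_coord_le_norm2.
Qed.

Lemma norm2_le_normr u : norm2 u <= Num.sqrt d%:R * `|u|.
Proof.
rewrite -ler_sqr ?nnegrE ?mulr_ge0 ?sqrtr_ge0 ?norm2_ge0//.
rewrite exprMn sqr_norm2 sqr_sqrtr ?ler0n// dotE mulr_natl.
rewrite -[X in _ *+ X]card_ord -sumr_const ler_sum// => i _.
rewrite -expr2 -[leLHS]real_normK ?num_real// ler_sqr ?nnegrE//.
by rewrite [`|u|]mx_normrE (le_bigmax _ _ (0, i)).
Qed.

Lemma dot_mulmxl u v M : dot (u *m M) v = dot u (v *m M^T).
Proof. by rewrite /dot trmx_mul trmxK mulmxA. Qed.

Lemma quadE M v : quad M v = dot (v *m M) v.
Proof. by []. Qed.

Lemma quadB M N v : quad (M - N) v = quad M v - quad N v.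
Proof. by rewrite !quadE mulmxBr dotBl. Qed.

Lemma quadZ a M v : quad M (a *: v) = a ^+ 2 * quad M v.
Proof. by rewrite !quadE -scalemxAl dotZl dotZr mulrA expr2. Qed.

Lemma quad_unit_dir M v : v != 0 ->
  quad M v = norm2 v ^+ 2 * quad M ((norm2 v)^-1 *: v).
Proof.
by move=> v0; rewrite -quadZ scalerA divff ?scale1r// norm2_eq0.
Qed.

Lemma norm2_unit_dir v : v != 0 -> norm2 ((norm2 v)^-1 *: v) = 1.
Proof.
move=> v0; rewrite norm2Z ger0_norm ?invr_ge0 ?norm2_ge0// mulVf//.
by rewrite norm2_eq0.
Qed.

(** The supremum in the spectral norm is a genuine upper bound: it is finite,
because the rows of [M] bound it. *)
Lemma norm2_mulmx_tr_le M v : norm2 (v *m M^T) <= spectral_norm M * norm2 v.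
Proof.
have [->|v0] := eqVneq v 0.
  by rewrite mul0mx (eqP (_ : norm2 0 == 0)) ?mulr0 ?norm2_eq0.
rewrite -ler_pdivrMr ?norm2_gt0// mulrC.
rewrite -[X in X * _]ger0_norm ?invr_ge0 ?norm2_ge0// -norm2Z scalemxAl.
apply: ub_le_sup; last first.
  by exists ((norm2 v)^-1 *: v) => //=; exact: norm2_unit_dir.
exists (Num.sqrt d%:R * (\sum_i norm2 (row i M))) => _ [u /= u1 <-].
apply: le_trans (norm2_le_normr _) _; rewrite ler_wpM2l ?sqrtr_ge0//.
rewrite [`|_|]mx_normrE; apply: bigmax_le => [|[i j] _]/=.
  by rewrite sumr_ge0// => i _; exact: norm2_ge0.
have -> : (u *m M^T) i j = dot u (row j M).
  by rewrite ord1 mxE dotE; apply: eq_bigr => k _; rewrite !mxE.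
apply: le_trans (cauchy_schwarz _ _) _; rewrite u1 mul1r.
by rewrite (bigD1 j)//= lerDl sumr_ge0// => k _; exact: norm2_ge0.
Qed.

Lemma spectral_norm_ge0 M : 0 <= spectral_norm M.
Proof.
have [[x x0]|n] := pselect (exists x : 'rV[R]_d, x != 0).
  have := le_trans (norm2_ge0 _) (norm2_mulmx_tr_le M x).
  by rewrite pmulr_lge0// norm2_gt0.
rewrite /spectral_norm (_ : [set _ | _ in _] = set0) ?sup0//.
apply/seteqP; split=> // _ [u /= u1 _]; apply: n; exists u.
by rewrite -norm2_eq0 u1 oner_eq0.
Qed.

Lemma dot_mulmx_le M u v : dot (u *m M) v <= spectral_norm M * norm2 u * norm2 v.
Proof.
rewrite dot_mulmxl (le_trans (dot_le_norm2 _ _))// mulrAC mulrC.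
by rewrite ler_wpM2r ?norm2_ge0// norm2_mulmx_tr_le.
Qed.

(** Testing against a second vector makes the bound linear in [M], so that it
passes to averages of matrices. *)
Lemma spectral_norm_le M c : 0 <= c ->
  (forall u v, dot (u *m M) v <= c * norm2 u * norm2 v) -> spectral_norm M <= c.
Proof.
move=> c0 h; have [[u0 u01]|n] := pselect (exists u : 'rV[R]_d, norm2 u = 1); last first.
  rewrite /spectral_norm (_ : [set _ | _ in _] = set0) ?sup0//.
  by apply/seteqP; split=> // _ [u /= u1 _]; apply: n; exists u.
apply: sup_le_ub; first by exists (norm2 (u0 *m M^T)); exists u0.
move=> _ [u /= u1 <-]; apply: norm2_le_dot => // v.
rewrite dotC -dot_mulmxl (le_trans (h _ _))// u1 mulr1//.
Qed.

Lemma quad_le M v : `|quad M v| <= spectral_norm M * norm2 v ^+ 2.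
Proof.
rewrite quadE ler_norml expr2 mulrA dot_mulmx_le andbT lerNl -dotNr.
by rewrite (le_trans (dot_mulmx_le _ _ _))// norm2N.
Qed.


Lemma dot_mulmx_sym M u v : M^T = M -> dot (u *m M) v = dot (v *m M) u.
Proof. by move=> sM; rewrite dot_mulmxl sM dotC. Qed.

Lemma quadDr M u v : M^T = M ->
  quad M (u + v) = quad M u + dot (u *m M) v *+ 2 + quad M v.
Proof.
move=> sM; rewrite !quadE mulmxDl dotDl !dotDr (dot_mulmx_sym v u sM) mulr2n; lra.
Qed.

Lemma continuous_quad M : continuous (quad M).
Proof.
rewrite (_ : quad M = fun v => \sum_(i < d) \sum_(j < d) v 0 j * M j i * v 0 i);
  last by apply/funext => v; rewrite quadE dotE; apply: eq_bigr => i _;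
          rewrite mxE mulr_suml.
have add_cont : continuous (fun z : R^o * R^o => z.1 + z.2) by exact: add_continuous.
apply: (continuous_big (U := R^o)) => // i _.
apply: (continuous_big (U := R^o)) => // j _.
have cc k : continuous (fun u : 'rV[R]_d => u 0 k) by exact: coord_continuous.
move=> v; apply: (@continuousM R 'rV[R]_d _ (fun u => u 0 i)); last exact: cc.
apply: (@continuousM R 'rV[R]_d (fun u => u 0 j)); first exact: cc.
exact: cst_continuous.
Qed.

End EuclideanSpace.

(** Variational characterization of the smallest eigenvalue: the quadratic form
attains its minimum on the compact unit sphere, a minimizer is an eigenvector,
and any other eigenvalue is itself a value of the form on the sphere. *)
Lemma lambda_min_attained {R : realType} {d : nat} (M : 'M[R]_d) :
  (0 < d)%N -> M^T = M ->
  exists2 v, norm2 v = 1 &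
    lambda_min M = quad M v /\
    forall u, lambda_min M * norm2 u ^+ 2 <= quad M u.
Proof.
move=> d0 sM.
pose S := [set v : 'rV[R]_d | norm2 v = 1].
have S0 : S !=set0 by exists (delta_mx 0 (Ordinal d0)); exact: norm2_delta.
have Sc : compact S.
  apply: bounded_closed_compact.
    exists 1; split; first exact: num_real.
    move=> x x1 v /= Sv; apply: le_trans (normr_le_norm2 _) _.
    by rewrite Sv ltW.
  rewrite (_ : S = quad 1%:M @^-1` [set 1]).
    by apply: preimage_closed; [move=> x _; exact: continuous_quad|exact: closed_eq].
  apply/seteqP; split=> [v /= v1|v /=].
    by rewrite quadE mulmx1 -sqr_norm2 v1 expr1n.
  rewrite quadE mulmx1 -sqr_norm2 => /eqP; rewrite sqrf_eq1 => /orP[]/eqP// vN1.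
  by have := norm2_ge0 v; rewrite vN1 lerNr oppr0 ler10.
have cq : {within S, continuous (quad M)}.
  exact/continuous_subspaceT/continuous_quad.
have [v] := EVT_min_rV S0 Sc cq.
rewrite inE /S /= => v1 vmin.
have qmin u : quad M v * norm2 u ^+ 2 <= quad M u.
  have [->|u0] := eqVneq u 0.
    by rewrite (eqP (_ : norm2 0 == 0)) ?norm2_eq0// expr0n mulr0 quadE mul0mx dot0l.
  rewrite (quad_unit_dir _ u0) mulrC ler_wpM2l ?sqr_ge0//.
  by apply: vmin; rewrite inE; exact: norm2_unit_dir.
(* The nonnegative form u |-> quad M u - quad M v * |u|^2 vanishes at v, and its
   first variation at v in the direction w := v *m M - quad M v *: v is
   2 |w|^2.  Hence w = 0. *)
have vM : v *m M = quad M v *: v.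
  pose w := v *m M - quad M v *: v.
  suff : dot w w <= 0.
    rewrite -sqr_norm2 => w0; apply/eqP; rewrite -subr_eq0 -norm2_eq0.
    by rewrite -sqrf_eq0 eq_le w0 sqr_ge0.
  have wv : dot (v *m M) w = quad M v * dot v w + dot w w.
    by rewrite -{1}(subrK (quad M v *: v) (v *m M)) -/w dotDl dotZl addrC.
  clearbody w.
  have vary t : 0 <= (dot w w) *+ 2 * t +
      (quad M w - quad M v * dot w w) * t ^+ 2.
    have := qmin (v + t *: w).
    rewrite quadDr// quadZ sqr_norm2 dotDl !dotDr -(sqr_norm2 v) v1.
    rewrite !(dotZl, dotZr) wv (dotC w v) !mulr2n; lra.
  have ww := dot_ge0 w.
  rewrite leNgt; apply/negP => ww0.
  (* A step of length |w|^2 / b against w would make the form negative. *)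
  pose b := `|quad M w - quad M v * dot w w| + 1.
  have b0 : 0 < b by rewrite /b ltr_wpDl.
  have bb : quad M w - quad M v * dot w w < b.
    by rewrite (le_lt_trans (ler_norm _))// ltrDl.
  have := vary (- (dot w w / b)).
  rewrite leNgt => /negP; apply.
  have e0 : 0 < dot w w / b by rewrite divr_gt0.
  have eb : dot w w = dot w w / b * b by rewrite divfK// gt_eqF.
  set e := dot w w / b in e0 eb *; rewrite sqrrN mulr2n {1 2}eb.
  rewrite (_ : _ + _ = e ^+ 2 * ((quad M w - quad M v * dot w w) - b *+ 2));
    last by rewrite mulr2n; ring.
  rewrite pmulr_rlt0 ?exprn_gt0// mulr2n; lra.
have eig a : eigenvalue M a -> quad M v <= a.
  move=> /eigenvalueP[u uM u0].
  have := qmin u; rewrite [quad M u]quadE uM dotZl -sqr_norm2 ler_pM2r//.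
  by rewrite exprn_gt0// norm2_gt0.
have veig : eigenvalue M (quad M v).
  by apply/eigenvalueP; exists v => //; rewrite -norm2_eq0 v1 oner_eq0.
suff lE : lambda_min M = quad M v by exists v => //; rewrite lE.
apply/eqP; rewrite eq_le; apply/andP; split.
  by apply: ge_inf => //; exists (quad M v).
by apply: lb_le_inf => //; exists (quad M v).
Qed.

Lemma lambda_min_geP {R : realType} {d : nat} (M : 'M[R]_d) c :
  (0 < d)%N -> M^T = M ->
  c <= lambda_min M <-> forall u, c * norm2 u ^+ 2 <= quad M u.
Proof.
move=> d0 sM; have [v v1 [lE lle]] := lambda_min_attained d0 sM.
split=> [cl u|/(_ v)]; last by rewrite v1 expr1n mulr1 lE.
by rewrite (le_trans _ (lle u))// ler_wpM2r// sqr_ge0.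
Qed.

(** * Taylor bounds for smooth functions *)

(** All Taylor estimates below come from this comparison: integrating a
quadratic upper bound on the derivative, by the mean value theorem. *)
Lemma le_of_derive_le_quadratic {R : realType} (phi dphi : R -> R) (a b c s : R) :
  0 <= s -> (forall t : R, is_derive t 1 phi (dphi t)) ->
  (forall t, 0 <= t <= s -> dphi t <= a + b * t + c * t ^+ 2) ->
  phi s <= phi 0 + a * s + b / 2 * s ^+ 2 + c / 3 * s ^+ 3.
Proof.
move=> s0 dp ub.
pose psi t := a * t + b / 2 * t ^+ 2 + c / 3 * t ^+ 3 - phi t.
pose dpsi t := a + b * t + c * t ^+ 2 - dphi t.
have dpsiP : forall r : R, is_derive r 1 psi (dpsi r).
  move=> r.
  have dpr := dp r; rewrite /psi /dpsi.
  apply: is_derive_eq; rewrite /GRing.scale/= !mulr1 -mulr_natr.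
  by field.
have cpsi : {within `[0, s], continuous psi}.
  apply: continuous_subspaceT => t; apply: differentiable_continuous.
  by apply/derivable1_diffP; have [] := dpsiP t.
have [t t0s] := MVT_segment s0 (fun t _ => dpsiP t) cpsi.
rewrite subr0 /psi !expr0n/= !mulr0 !addr0 sub0r opprK.
move: t0s; rewrite in_itv/= => /ub; rewrite /dpsi -subr_ge0 => ub0 e.
have := mulr_ge0 ub0 s0; rewrite -e; lra.
Qed.

Lemma normr_increment_sub_le {R : realType} (phi dphi : R -> R) (a b k : R) :
  (forall t : R, is_derive t 1 phi (dphi t)) ->
  (forall t, 0 <= t <= 1 -> `|dphi t - a| <= b + k * t) ->
  `|phi 1 - phi 0 - a| <= b + k / 2.
Proof.
move=> dp ub; rewrite ler_norml; apply/andP; split.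
  have dN (t : R) : is_derive t 1 (- phi) (- dphi t).
    by have dpt := dp t; exact: is_deriveN.
  have := @le_of_derive_le_quadratic _ _ _ (b - a) k 0 1 ler01 dN.
  rewrite /= !mulr1 !expr1n !mulr1 mul0r addr0 !fctE => /(_ _)/wrap[|]; last lra.
  by move=> t /ub; rewrite mul0r addr0 ler_norml => /andP[+ _]; lra.
have := @le_of_derive_le_quadratic _ _ _ (b + a) k 0 1 ler01 dp.
rewrite /= !mulr1 !expr1n !mulr1 mul0r addr0 => /(_ _)/wrap[|]; last lra.
by move=> t /ub; rewrite mul0r addr0 ler_norml => /andP[_]; lra.
Qed.

Lemma continuous_of_bound {R : realType} {V W : normedModType R}
    (f : {linear V -> W}) (K : R) :
  (forall v, `|f v| <= K * `|v|) -> continuous f.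
Proof.
move=> fK; apply/bounded_linear_continuous/bounded_funP => r.
exists (`|K| * r) => v vr; apply: le_trans (fK v) _.
apply: (@le_trans _ _ (`|K| * `|v|)); first by rewrite ler_wpM2r// ler_norm.
by rewrite ler_wpM2l.
Qed.

Lemma is_derive_line {R : realType} {d : nat} {W : normedModType R}
    (G : 'rV[R]_d -> W) (x h : 'rV[R]_d) (t : R) :
  derivable G (x + t *: h) h ->
  is_derive t 1 (fun s => G (x + s *: h)) ('D_h G (x + t *: h)).
Proof.
move=> dG.
have e : (fun s : R => s^-1 *: ((G \o shift (x + t *: h)) (s *: h) - G (x + t *: h))) =
    (fun s : R => s^-1 *: (((fun s => G (x + s *: h)) \o shift t) (s *: 1) -
                       G (x + t *: h))).
  apply/funext => s /=; congr (_ *: (G _ - _)).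
  by rewrite [s *: 1]mulr1 scalerDl addrCA.
by split; rewrite /derivable /derive -e.
Qed.

Section Gradient.
Context {R : realType} {d : nat}.
Implicit Types (F : 'rV[R]_d -> R) (x h u v : 'rV[R]_d).

Lemma derive_grad F x h : differentiable F x -> 'D_h F x = dot (grad F x) h.
Proof.
move=> dF; rewrite deriveE// {1}(row_sum_delta h) linear_sum dotE.
by apply: eq_bigr => i _; rewrite linearZ/= mxE -deriveE// mulrC.
Qed.

Lemma is_derive_line_grad F x h t : differentiable F (x + t *: h) ->
  is_derive t 1 (fun s => F (x + s *: h)) (dot (grad F (x + t *: h)) h).
Proof.
by move=> dF; rewrite -derive_grad//; apply: is_derive_line; exact: diff_derivable.
Qed.

Lemma is_derive_line_hess F x h u t : differentiable (grad F) (x + t *: h) ->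
  is_derive t 1 (fun s => dot (grad F (x + s *: h)) u)
    (dot (h *m hess F (x + t *: h)) u).
Proof.
move=> dG; rewrite /hess -deriveEjacobian//.
pose l v := dot v u.
have l_lin : linear l by move=> a v w; rewrite /l dotDl dotZl.
pose lM := GRing.isLinear.Build _ _ _ _ l l_lin.
pose L : {linear 'rV[R]_d -> R} := HB.pack l lM.
have cL : continuous L.
  apply: (@continuous_of_bound _ _ _ _ (Num.sqrt d%:R * norm2 u)) => v.
  apply: le_trans (cauchy_schwarz _ _) _.
  by rewrite mulrAC ler_wpM2r ?norm2_ge0// norm2_le_normr.
have dL y : differentiable L y by exact: linear_differentiable.
have dLG : differentiable (L \o grad F) (x + t *: h) by exact: differentiable_comp.
have dvLG : derivable (L \o grad F) (x + t *: h) h by exact: diff_derivable.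
have dE : 'D_h (L \o grad F) (x + t *: h) = dot ('D_h (grad F) (x + t *: h)) u.
  rewrite (deriveE h dLG) (diff_comp dG (dL _)) (deriveE h dG).
  by rewrite /= (diff_lin _ cL).
have := is_derive_line dvLG; rewrite dE; exact.
Qed.

End Gradient.

Lemma le_of_le_affine {R : realType} (a b c : R) :
  (forall t, 0 < t -> a <= b + c * t) -> a <= b.
Proof.
move=> h; rewrite leNgt; apply/negP => ba.
have c0 : 0 < `|c| + 1 by rewrite ltr_wpDl.
pose t := (a - b) / (2 * (`|c| + 1)).
have t0 : 0 < t by rewrite divr_gt0 ?subr_gt0// mulr_gt0.
have tE : t * (`|c| + 1) = (a - b) / 2.
  by rewrite /t; field; rewrite gt_eqF.
have := h t t0; have := ler_wpM2r (ltW t0) (ler_norm c); lra.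
Qed.

Section SmoothFunction.
Context {R : realType} {d : nat} (L1 L2 : R) (F : 'rV[R]_d -> R).
Hypothesis F_smooth : smooth_component L1 L2 F.
Implicit Types (x h u v : 'rV[R]_d).

Let dF x : differentiable F x. Proof. by have [[]] := F_smooth. Qed.
Let dG x : differentiable (grad F) x. Proof. by have [[]] := F_smooth. Qed.
Let lipG x y : norm2 (grad F x - grad F y) <= L1 * norm2 (x - y).
Proof. by have [] := F_smooth. Qed.
Let lipH x y : spectral_norm (hess F x - hess F y) <= L2 * norm2 (x - y).
Proof. by have [] := F_smooth. Qed.

Lemma hess_lipschitz_dot x y u v :
  dot (u *m (hess F x - hess F y)) v <= L2 * norm2 (x - y) * norm2 u * norm2 v.
Proof.
apply: le_trans (dot_mulmx_le _ _ _) _.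
by rewrite ler_wpM2r ?norm2_ge0// ler_wpM2r ?norm2_ge0.
Qed.

Lemma taylor1 x h :
  `|F (x + h) - F x - dot (grad F x) h| <= L1 / 2 * norm2 h ^+ 2.
Proof.
have := @normr_increment_sub_le _ _ _ (dot (grad F x) h) 0 (L1 * norm2 h ^+ 2)
  (fun t => is_derive_line_grad (dF (x + t *: h))).
rewrite scale0r scale1r addr0 add0r mulrAC; apply=> t /andP[t0 _].
rewrite -dotBl add0r; apply: le_trans (cauchy_schwarz _ _) _.
rewrite expr2 mulrA mulrAC ler_wpM2r ?norm2_ge0//.
by rewrite (le_trans (lipG _ _))// addrC addKr norm2Z ger0_norm// mulrA mulrAC.
Qed.

Lemma grad_taylor1 x h u :
  `|dot (grad F (x + h) - grad F x - h *m hess F x) u| <=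
  L2 / 2 * norm2 h ^+ 2 * norm2 u.
Proof.
have := @normr_increment_sub_le _ _ _ (dot (h *m hess F x) u) 0
  (L2 * norm2 h ^+ 2 * norm2 u)
  (fun t => is_derive_line_hess u (dG (x + t *: h))).
rewrite scale0r scale1r addr0 add0r -!dotBl.
rewrite (_ : _ / 2 = L2 / 2 * norm2 h ^+ 2 * norm2 u); last by lra.
apply=> t /andP[t0 _].
rewrite add0r -dotBl -mulmxBr ler_norml; apply/andP; split.
  rewrite lerNl -dotNr (le_trans (hess_lipschitz_dot _ _ _ _))//.
  by rewrite addrC addKr norm2Z ger0_norm// norm2N; lra.
rewrite (le_trans (hess_lipschitz_dot _ _ _ _))//.
by rewrite addrC addKr norm2Z ger0_norm//; lra.
Qed.

(** The Hessian bound is integrated twice along the segment: once to control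
the slope at each intermediate point, once more to control the value. *)
Lemma taylor2_le x h :
  F (x + h) <= F x + dot (grad F x) h + quad (hess F x) h / 2 +
               L2 / 6 * norm2 h ^+ 3.
Proof.
have grow s : 0 <= s -> dot (grad F (x + s *: h)) h <=
    dot (grad F x) h + quad (hess F x) h * s + L2 / 2 * norm2 h ^+ 3 * s ^+ 2.
  move=> s0.
  have := @le_of_derive_le_quadratic _ _ _ (quad (hess F x) h)
    (L2 * norm2 h ^+ 3) 0 s s0 (fun t => is_derive_line_hess h (dG (x + t *: h))).
  rewrite scale0r addr0 => /(_ _)/wrap[|]; last lra.
  move=> t /andP[t0 _]; rewrite mul0r addr0 quadE -lerBlDl -dotBl -mulmxBr.
  rewrite (le_trans (hess_lipschitz_dot _ _ _ _))//.
  by rewrite addrC addKr norm2Z ger0_norm//; lra.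
have := @le_of_derive_le_quadratic _ _ _ (dot (grad F x) h) (quad (hess F x) h)
    (L2 / 2 * norm2 h ^+ 3) 1 ler01 (fun t => is_derive_line_grad (dF (x + t *: h))).
rewrite scale0r scale1r addr0 => /(_ _)/wrap[t /andP[t0 _]|]; first exact: grow.
by lra.
Qed.

(** [h *m hess F x] is the limit of the difference quotients of the gradient in
the direction [h], each of which has norm at most [L1 * norm2 h]. *)
Lemma hess_dot_le x h u : dot (h *m hess F x) u <= L1 * norm2 h * norm2 u.
Proof.
apply: (@le_of_le_affine _ _ _ (L2 / 2 * norm2 h ^+ 2 * norm2 u)) => t t0.
have := grad_taylor1 x (t *: h) u.
rewrite dotBl ler_norml => /andP[+ _].
have := cauchy_schwarz (grad F (x + t *: h) - grad F x) u.
have := ler_wpM2r (norm2_ge0 u) (lipG (x + t *: h) x).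
rewrite (addrC x) addrK norm2Z (ger0_norm (ltW t0)) -scalemxAl dotZl ler_norml.
move=> l1 /andP[_ l2] l3.
rewrite -(ler_pM2l t0).
lra.
Qed.

Lemma spectral_norm_hess_le x : 0 <= L1 -> spectral_norm (hess F x) <= L1.
Proof. by move=> L10; apply/spectral_norm_le => // u v; exact: hess_dot_le. Qed.

(** The mixed second difference is the increment along [s *: u] of the function
[y |-> F (y + s *: v) - F y]; the slope of that function is compared with the
Hessian at [x] by the Taylor bound on the gradient. *)
Lemma mixed_difference x u v : 0 <= L2 -> exists C, forall s, 0 < s ->
  `|F (x + s *: v + s *: u) - F (x + s *: u) - (F (x + s *: v) - F x)
    - s ^+ 2 * dot (v *m hess F x) u| <= C * s ^+ 3.
Proof.
move=> L20; pose K w := L2 / 2 * w ^+ 2 * norm2 u.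
exists (K (norm2 v + norm2 u) + K (norm2 u)) => s s0.
have dphi (t : R) : is_derive t 1
    ((fun t => F (x + s *: v + t *: (s *: u))) - (fun t => F (x + t *: (s *: u))))
    (dot (grad F (x + s *: v + t *: (s *: u))) (s *: u) -
     dot (grad F (x + t *: (s *: u))) (s *: u)).
  have h1 := is_derive_line_grad (dF (x + s *: v + t *: (s *: u))).
  have h2 := is_derive_line_grad (dF (x + t *: (s *: u))).
  exact: is_deriveB.
have := normr_increment_sub_le (a := s ^+ 2 * dot (v *m hess F x) u)
  (b := (K (norm2 v + norm2 u) + K (norm2 u)) * s ^+ 3) (k := 0) dphi.
rewrite !fctE /= !scale0r !scale1r !addr0 mul0r addr0; apply=> t /andP[t0 t1].
rewrite mul0r addr0 -(addrA x).
have g1 := grad_taylor1 x (s *: v + t *: (s *: u)) u.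
have g2 := grad_taylor1 x (t *: (s *: u)) u.
have n1 : norm2 (s *: v + t *: (s *: u)) <= s * (norm2 v + norm2 u).
  rewrite (le_trans (norm2_triangle _ _))// !norm2Z !ger0_norm ?(ltW s0)//.
  by rewrite mulrDr lerD2l ler_piMl// mulr_ge0 ?norm2_ge0// ltW.
have n2 : norm2 (t *: (s *: u)) <= s * norm2 u.
  rewrite !norm2Z !ger0_norm ?(ltW s0)//.
  by rewrite ler_piMl// mulr_ge0 ?norm2_ge0// ltW.
have sqr_bound (w : 'rV[R]_d) c : norm2 w <= s * c ->
    L2 / 2 * norm2 w ^+ 2 * norm2 u <= s ^+ 2 * K c.
  move=> wc; have -> : s ^+ 2 * K c = L2 / 2 * (s * c) ^+ 2 * norm2 u.
    by rewrite /K; ring.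
  rewrite ler_wpM2r ?norm2_ge0// ler_wpM2l ?divr_ge0//.
  by rewrite ler_sqr ?nnegrE ?norm2_ge0// (le_trans _ wc)// norm2_ge0.
move: g1 g2 (sqr_bound _ _ n1) (sqr_bound _ _ n2).
set A := dot (_ - _) u; set B := dot (_ - _ - _) u => gA gB bA bB.
rewrite (_ : _ - _ - _ = s * (A - B)); last first.
  rewrite /A /B mulmxDl -!scalemxAl !(dotBl, dotDl, dotZl, dotZr) !addrA; ring.
rewrite normrM (gtr0_norm s0) [leRHS](_ : _ = s * (s ^+ 2 * K (norm2 v + norm2 u) +
  s ^+ 2 * K (norm2 u))); last by ring.
rewrite ler_wpM2l ?(ltW s0)// (le_trans (ler_normB _ _))// lerD//.
  exact: le_trans bA.
exact: le_trans bB.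
Qed.

(** The mixed second difference is symmetric in [u] and [v] and approximates
both [s ^ 2 * dot (v *m hess F x) u] and [s ^ 2 * dot (u *m hess F x) v] up to
[O(s ^ 3)]; let [s] tend to [0]. *)
Lemma hess_sym x : 0 <= L2 -> (hess F x)^T = hess F x.
Proof.
move=> L20.
have sym u v : dot (v *m hess F x) u <= dot (u *m hess F x) v.
  have [C1 h1] := mixed_difference x u v L20.
  have [C2 h2] := mixed_difference x v u L20.
  apply: (@le_of_le_affine _ _ _ (C1 + C2)) => s s0.
  have := h1 s s0; have := h2 s s0.
  rewrite (addrAC x (s *: u)) !ler_norml => /andP[_ l2] /andP[l1 _].
  rewrite -(ler_pM2l (exprn_gt0 2 s0)); lra.
apply/matrixP => i j; rewrite [LHS]mxE.
have entry a b : hess F x a b = dot (delta_mx 0 a *m hess F x) (delta_mx 0 b).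
  by rewrite dot_delta -rowE [RHS]mxE.
by apply/eqP; rewrite eq_le !entry !sym.
Qed.

End SmoothFunction.

Section QuadraticRemainder.
Context {R : realType} {d : nat}.

(** A quadratic remainder is little-o of the increment; the Euclidean norm of
the remainder is first compared with the sup norm that carries the topology. *)
Lemma diff_of_quadratic_remainder {W : normedModType R} (G : 'rV[R]_d -> W)
    (L : {linear 'rV[R]_d -> W}) (x : 'rV[R]_d) (C K : R) :
  (forall v, `|L v| <= C * `|v|) ->
  (forall h, `|G (x + h) - G x - L h| <= K * norm2 h ^+ 2) ->
  differentiable G x /\ 'd G x = L :> ('rV[R]_d -> W).
Proof.
move=> LC GK; have cL := continuous_of_bound LC.
have Go : G \o shift x = cst (G x) + L +o_ (0 : 'rV[R]_d) id.
  apply: (proj2 (eqaddoP _ _ _ _)) => e e0.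
  set D := `|K| * d%:R + 1.
  have D0 : 0 < D by rewrite ltr_wpDl// mulr_ge0.
  have eD0 : 0 < e / D by rewrite divr_gt0.
  near=> h.
  rewrite !fctE /= opprD addrA (addrC h) (le_trans (GK h))//.
  have hD : `|h| <= e / D.
    near: h; apply/nbhs_ballP; exists (e / D) => //=.
    by move=> y; rewrite -ball_normE/= sub0r normrN => /ltW.
  apply: (@le_trans _ _ (D * `|h| * `|h|)); last first.
    by rewrite ler_wpM2r// mulrC -ler_pdivlMr.
  have nh : norm2 h ^+ 2 <= d%:R * `|h| ^+ 2.
    rewrite (le_trans (_ : _ <= (Num.sqrt d%:R * `|h|) ^+ 2))//.
      by rewrite ler_sqr ?nnegrE ?norm2_ge0 ?mulr_ge0 ?sqrtr_ge0// norm2_le_normr.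
    by rewrite exprMn sqr_sqrtr.
  rewrite (le_trans (ler_wpM2r (sqr_ge0 _) (ler_norm K)))//.
  rewrite (le_trans (ler_wpM2l (normr_ge0 K) nh))// mulrA -[leRHS]mulrA -expr2.
  by rewrite ler_wpM2r ?sqr_ge0// lerDl.
have dE := diff_unique cL Go; split => //.
by apply/diff_locallyP; rewrite dE.
Unshelve. all: by end_near. Qed.

Lemma gradient_of_quadratic_remainder (F : 'rV[R]_d -> R) x g K :
  (forall h, `|F (x + h) - F x - dot g h| <= K * norm2 h ^+ 2) ->
  differentiable F x /\ grad F x = g.
Proof.
move=> FK; pose l v := dot g v.
have l_lin : linear l by move=> a v w; rewrite /l dotDr dotZr.
pose lM := GRing.isLinear.Build _ _ _ _ l l_lin.
pose L : {linear 'rV[R]_d -> R} := HB.pack l lM.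
have [|dF dE] := @diff_of_quadratic_remainder R F L x (norm2 g * Num.sqrt d%:R) K _ FK.
  move=> v; rewrite (le_trans (cauchy_schwarz _ _))// -mulrA.
  by rewrite ler_wpM2l ?norm2_ge0// norm2_le_normr.
by split=> //; apply/rowP => i; rewrite mxE deriveE// dE/= /l dot_delta.
Qed.

Lemma jacobian_of_quadratic_remainder (G : 'rV[R]_d -> 'rV[R]_d) x (M : 'M[R]_d) K :
  (forall h, norm2 (G (x + h) - G x - h *m M) <= K * norm2 h ^+ 2) ->
  differentiable G x /\ 'J G x = M.
Proof.
move=> GK.
have [v|h|dG dE] := @diff_of_quadratic_remainder _ G (mulmxr M) x
   (spectral_norm M^T * Num.sqrt d%:R) K.
- rewrite (le_trans (normr_le_norm2 _))//= -{1}(trmxK M).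
  rewrite (le_trans (norm2_mulmx_tr_le _ _))// -mulrA.
  by rewrite ler_wpM2l ?spectral_norm_ge0// norm2_le_normr.
- by rewrite (le_trans (normr_le_norm2 _)).
by split=> //; apply/row_matrixP => i; rewrite !rowE mul_rV_lin1 dE.
Qed.

End QuadraticRemainder.

(** * Averages of smooth functions are smooth *)

(** Convergence at rate [K / n.+1] is all that difference quotients of smooth
functions provide and all that the closure is asked for. *)
Definition uniformly_closed {R : realType} {T : Type} (I : set (T -> R)) : Prop :=
  [/\ I (fun=> 0),
      forall a g h, I g -> I h -> I (fun t => a * g t + h t) &
      forall g K, (forall n, exists2 h, I h &
        forall t, `|g t - h t| <= K / n.+1%:R) -> I g].

(** The common features of a finite average (where [I] is everything) and of an
integral against a probability (where [I] is the integrable functions). *)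
Definition mean_functional {R : realType} {T : Type} (I : set (T -> R))
    (E : (T -> R) -> R) : Prop :=
  [/\ E (fun=> 0) = 0,
      forall a g h, I g -> I h -> E (fun t => a * g t + h t) = a * E g + E h &
      forall g c, I g -> (forall t, g t <= c) -> E g <= c].

Section ClosedSpace.
Context {R : realType} {T : Type} (I : set (T -> R)).
Hypothesis I_closed : uniformly_closed I.

Lemma closed_ext g h : I g -> g =1 h -> I h.
Proof. by move=> Ig /funext <-. Qed.

Lemma closedD g h : I g -> I h -> I (fun t => g t + h t).
Proof.
have [_ lin _] := I_closed => Ig Ih.
by apply: closed_ext (lin 1 g h Ig Ih) _ => t; rewrite mul1r.
Qed.

Lemma closedZ a g : I g -> I (fun t => a * g t).
Proof.
have [I0 lin _] := I_closed => Ig.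
by apply: closed_ext (lin a g _ Ig I0) _ => t; rewrite addr0.
Qed.

Lemma closedB g h : I g -> I h -> I (fun t => g t - h t).
Proof.
have [_ lin _] := I_closed => Ig Ih.
by apply: closed_ext (lin (-1) h g Ih Ig) _ => t; rewrite mulN1r addrC.
Qed.

Lemma closed_sum (J : Type) (r : seq J) (g : J -> T -> R) :
  (forall i, I (g i)) -> I (fun t => \sum_(i <- r) g i t).
Proof.
have [I0 _ _] := I_closed => Ig; elim: r => [|i r ih].
  by apply: closed_ext I0 _ => t; rewrite big_nil.
by apply: closed_ext (closedD (Ig i) ih) _ => t; rewrite big_cons.
Qed.

Lemma closed_dot d (V : T -> 'rV[R]_d) u :
  (forall i, I (fun t => V t 0 i)) -> I (fun t => dot (V t) u).
Proof.
move=> IV; have IuV i := closedZ (u 0 i) (IV i).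
apply: closed_ext (closed_sum (index_enum 'I_d) IuV) _ => t.
by rewrite dotE; apply: eq_bigr => i _; rewrite mulrC.
Qed.

Section Derivatives.
Context {d : nat} (L1 L2 : R) (F : T -> 'rV[R]_d -> R).
Hypothesis F_smooth : forall t, smooth_component L1 L2 (F t).
Hypothesis IF : forall x, I (F ^~ x).

(** Difference quotients converge to the derivative at a rate that is uniform
in the parameter, so the class [I] contains the partial derivatives. *)
Lemma grad_closed x i : I (fun t => grad (F t) x 0 i).
Proof.
have [_ _ ucl] := I_closed.
apply: (ucl _ (L1 / 2)) => n.
exists (fun t => n.+1%:R * (F t (x + n.+1%:R^-1 *: delta_mx 0 i) - F t x)).
  exact/closedZ/closedB.
move=> t; have := taylor1 (F_smooth t) x (n.+1%:R^-1 *: delta_mx 0 i).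
rewrite dotZr dot_delta norm2Z norm2_delta mulr1 normfV (ger0_norm (ler0n R n.+1)) => h.
rewrite distrC -(ler_pM2l (_ : 0 < n.+1%:R^-1)) ?invr_gt0//.
rewrite -[X in X * `|_|]ger0_norm ?invr_ge0// -normrM mulrBr mulKf//.
by rewrite (le_trans h)// expr2 mulrCA.
Qed.

Lemma hess_closed x i j : I (fun t => hess (F t) x i j).
Proof.
have [_ _ ucl] := I_closed.
apply: (ucl _ (L2 / 2)) => n.
exists (fun t => n.+1%:R *
  (grad (F t) (x + n.+1%:R^-1 *: delta_mx 0 i) 0 j - grad (F t) x 0 j)).
  by apply/closedZ/closedB; exact: grad_closed.
move=> t.
have := grad_taylor1 (F_smooth t) x (n.+1%:R^-1 *: delta_mx 0 i) (delta_mx 0 j).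
rewrite -scalemxAl !dotBl dotZl !dot_delta -rowE [row _ _ 0 j]mxE norm2_delta mulr1.
rewrite norm2Z norm2_delta mulr1 normfV (ger0_norm (ler0n R n.+1)) => h.
rewrite distrC -(ler_pM2l (_ : 0 < n.+1%:R^-1)) ?invr_gt0//.
rewrite -[X in X * `|_|]ger0_norm ?invr_ge0// -normrM mulrBr mulKf//.
by rewrite (le_trans h)// expr2 mulrCA.
Qed.

Section Expectation.
Context (E : (T -> R) -> R).
Hypothesis E_exp : mean_functional I E.
Implicit Types (x u v : 'rV[R]_d).

Lemma mean_functionalD g h : I g -> I h -> E (fun t => g t + h t) = E g + E h.
Proof.
have [_ lin _] := E_exp => Ig Ih.
rewrite -[E g]mul1r -lin//; congr E; apply/funext => t; by rewrite mul1r.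
Qed.

Lemma mean_functionalZ a g : I g -> E (fun t => a * g t) = a * E g.
Proof.
have [E0 lin _] := E_exp; have [I0 _ _] := I_closed => Ig.
rewrite -[RHS]addr0 -E0 -lin//; congr E; apply/funext => t; by rewrite addr0.
Qed.

Lemma mean_functionalB g h : I g -> I h -> E (fun t => g t - h t) = E g - E h.
Proof.
have [_ lin _] := E_exp => Ig Ih.
rewrite addrC -mulN1r -lin//; congr E; apply/funext => t; by rewrite mulN1r addrC.
Qed.

Lemma mean_functional_sum (J : Type) (r : seq J) (g : J -> T -> R) :
  (forall i, I (g i)) -> E (fun t => \sum_(i <- r) g i t) = \sum_(i <- r) E (g i).
Proof.
have [E0 _ _] := E_exp => Ig; elim: r => [|i r ih].
  by rewrite big_nil -[RHS]E0; congr E; apply/funext => t; rewrite big_nil.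
rewrite big_cons -ih -mean_functionalD//; last exact: closed_sum.
by congr E; apply/funext => t; rewrite big_cons.
Qed.

Lemma mean_functional_normr_le g c : I g -> (forall t, `|g t| <= c) -> `|E g| <= c.
Proof.
have [_ _ le] := E_exp => Ig gc; rewrite ler_norml lerNl; apply/andP; split.
  rewrite -mulN1r -mean_functionalZ// le//; first exact: closedZ.
  by move=> t; rewrite mulN1r lerNl; have := gc t; rewrite ler_norml => /andP[].
by apply: le => // t; exact: le_trans (ler_norm _) (gc t).
Qed.

Definition mean_row (V : T -> 'rV[R]_d) : 'rV[R]_d := \row_i E (fun t => V t 0 i).

Lemma mean_functional_dot (V : T -> 'rV[R]_d) u : (forall i, I (fun t => V t 0 i)) ->
  E (fun t => dot (V t) u) = dot (mean_row V) u.
Proof.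
move=> IV; rewrite dotE.
transitivity (E (fun t => \sum_i u 0 i * V t 0 i)).
  by congr E; apply/funext => t; rewrite dotE; apply: eq_bigr => i _; rewrite mulrC.
rewrite mean_functional_sum; last by move=> i; exact/closedZ.
by apply: eq_bigr => i _; rewrite mxE mean_functionalZ// mulrC.
Qed.

Lemma mean_functional_dotB (V W : T -> 'rV[R]_d) u :
  (forall i, I (fun t => V t 0 i)) -> (forall i, I (fun t => W t 0 i)) ->
  E (fun t => dot (V t - W t) u) = dot (mean_row V - mean_row W) u.
Proof.
move=> IV IW; rewrite dotBl -!mean_functional_dot// -mean_functionalB;
  try exact: closed_dot.
by congr E; apply/funext => t; rewrite dotBl.
Qed.

Let G x := mean_row (fun t => grad (F t) x).
Let M x : 'M[R]_d := \matrix_(i, j) E (fun t => hess (F t) x i j).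

Lemma hess_row_closed x (h : 'rV[R]_d) j : I (fun t => (h *m hess (F t) x) 0 j).
Proof.
have IhH i := closedZ (h 0 i) (hess_closed x i j).
apply: closed_ext (closed_sum (index_enum 'I_d) IhH) _ => t.
by rewrite mxE.
Qed.

Lemma mean_row_hess x (h : 'rV[R]_d) : mean_row (fun t => h *m hess (F t) x) = h *m M x.
Proof.
apply/rowP => j; rewrite !mxE.
transitivity (E (fun t => \sum_i h 0 i * hess (F t) x i j)).
  by congr E; apply/funext => t; rewrite mxE.
rewrite mean_functional_sum; last by move=> i; exact/closedZ/hess_closed.
by apply: eq_bigr => i _; rewrite mxE mean_functionalZ//; exact: hess_closed.
Qed.

(** The Taylor remainders of the [F t] have quadratic bounds that are uniform in
[t].  Averaging these bounds gives the same bounds for the average, with the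
averaged gradient and Hessian as coefficients; and a quadratic remainder forces
those coefficients to be the derivatives of the average. *)
Lemma smooth_component_expectation (f : 'rV[R]_d -> R) : 0 <= L1 -> 0 <= L2 ->
  (forall x, f x = E (F ^~ x)) -> smooth_component L1 L2 f.
Proof.
move=> L10 L20 fE.
have IG x u : I (fun t => dot (grad (F t) x) u).
  by apply: closed_dot => i; exact: grad_closed.
have IH x (h : 'rV[R]_d) u : I (fun t => dot (h *m hess (F t) x) u).
  by apply: closed_dot => i; exact: hess_row_closed.
have fG x : differentiable f x /\ grad f x = G x.
  apply: (@gradient_of_quadratic_remainder _ _ _ _ _ (L1 / 2)) => h.
  rewrite !fE -mean_functional_dot; last by move=> i; exact: grad_closed.
  rewrite -!mean_functionalB//; last exact: closedB.
  apply: mean_functional_normr_le; first by apply: closedB => //; exact: closedB.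
  by move=> t; exact: taylor1.
have mean_hess := mean_row_hess.
have gradE : grad f = G by apply/funext => x; have [] := fG x.
have GH x : differentiable (grad f) x /\ hess f x = M x.
  rewrite gradE; rewrite /hess gradE.
  apply: (@jacobian_of_quadratic_remainder _ _ _ _ _ (L2 / 2)) => h.
  apply: norm2_le_dot => [|u]; first by rewrite mulr_ge0 ?sqr_ge0// divr_ge0.
  rewrite !dotBl -mean_row_hess -!mean_functional_dot;
    try by move=> i; first [exact: hess_row_closed|exact: grad_closed].
  rewrite -!mean_functionalB//; last exact: closedB.
  have [_ _ le] := E_exp; apply: le; first by apply: closedB => //; exact: closedB.
  move=> t; rewrite -!dotBl (le_trans (ler_norm _))//.
  exact: (grad_taylor1 (F_smooth t)).
clearbody M.
split.
- by split=> x; [have [] := fG x|have [] := GH x].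
- move=> x y; apply: norm2_le_dot => [|u]; first by rewrite mulr_ge0 ?norm2_ge0.
  rewrite gradE dotBl -!mean_functional_dot; last 2 first.
  - by move=> i; exact: grad_closed.
  - by move=> i; exact: grad_closed.
  rewrite -mean_functionalB//.
  have [_ _ le] := E_exp; apply: le; first exact: closedB.
  move=> t; rewrite -dotBl (le_trans (dot_le_norm2 _ _))// ler_wpM2r ?norm2_ge0//.
  by have [_] := F_smooth t.
- move=> x y; apply: spectral_norm_le => [|u v]; first by rewrite mulr_ge0 ?norm2_ge0.
  rewrite (proj2 (GH x)) (proj2 (GH y)) mulmxBr -(mean_hess x u).
  rewrite -(mean_hess y u) -(mean_functional_dotB v (hess_row_closed x u)
    (hess_row_closed y u)).
  have [_ _ le] := E_exp; apply: le.
    apply: closed_dot => i.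
    have subE (a b : 'rV[R]_d) : a 0 i - b 0 i = (a - b) 0 i by rewrite !mxE.
    apply: closed_ext (closedB (hess_row_closed x u i) (hess_row_closed y u i)) _ => t.
    exact: subE.
  move=> t; rewrite -mulmxBr.
  exact: (hess_lipschitz_dot (F_smooth t)).
Qed.

End Expectation.
End Derivatives.
End ClosedSpace.

Lemma cvg_of_le_div {R : realType} (u : nat -> R) (l K : R) :
  (forall n, `|l - u n| <= K / n.+1%:R) -> u @ \oo --> l.
Proof.
move=> ul; apply: cvg_sub0 (cvg_cst l); apply: norm_cvg0.
apply: (@squeeze_cvgr _ _ _ _ (fun=> 0) (fun n => K * harmonic n)).
- by near=> n; rewrite normr_ge0 distrC ul.
- exact: cvg_cst.
- by rewrite -[X in _ --> X](mulr0 K); apply: cvgMr; exact: cvg_harmonic.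
Unshelve. all: by end_near. Qed.

Lemma uniformly_closed_measurable {R : realType} {dT : measure_display}
    {T : measurableType dT} :
  uniformly_closed [set g : T -> R | measurable_fun setT g].
Proof.
split=> [|a g h mg mh|g K gK] /=; first exact: measurable_cst.
  by apply: measurable_funD => //; exact: measurable_funM.
have /choice[h_ h_P] : forall n, exists h : T -> R, measurable_fun setT h /\
    forall t, `|g t - h t| <= K / n.+1%:R.
  by move=> n; have [h mh gh] := gK n; exists h.
apply: (measurable_fun_cvg (h := h_)) => [n|t _]; first by have [] := h_P n.
by apply: cvg_of_le_div => n; have [_] := h_P n; apply.
Qed.

Section Integral.
Context {R : realType} {dT : measure_display} {T : measurableType dT}
  (Q : probability T R).

Lemma uniformly_closed_integrable :
  uniformly_closed [set g : T -> R | Q.-integrable setT (EFin \o g)].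
Proof.
have icst (c : R) : Q.-integrable setT (EFin \o cst c).
  exact: finite_measure_integrable_cst.
split=> [|a g h ig ih|g K gK] /=; first exact: (icst 0).
  apply: (eq_integrable measurableT (fun t => a%:E * (g t)%:E + (h t)%:E)%E) => //.
  by apply: integrableD => //; exact: integrableZl.
have mg : measurable_fun setT g.
  have [_ _ ucl] := @uniformly_closed_measurable R _ T; apply: (ucl _ K) => n.
  have [h ih hg] := gK n; exists h => //=.
  exact/measurable_EFinP/(measurable_int _ ih).
have [h ih hg] := gK 0; rewrite divr1 in hg.
apply: (@le_integrable _ _ _ _ _ _ _ (fun t => `|(h t)%:E| + (`|K|)%:E)%E) => //.
- exact/measurable_EFinP.
- move=> t _; rewrite /= lee_fin [leRHS]ger0_norm ?addr_ge0// -(subrK (h t) (g t)).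
  rewrite addrC (le_trans (ler_normD _ _))// lerD2r.
  by rewrite (le_trans (hg t))// ler_norm.
- by apply: integrableD => //; [exact: integrable_abse|exact: icst].
Qed.

Lemma mean_functional_integral : mean_functional
  [set g : T -> R | Q.-integrable setT (EFin \o g)] (fun g => \int[Q]_t g t).
Proof.
have icst (c : R) : Q.-integrable setT (EFin \o cst c).
  exact: finite_measure_integrable_cst.
split=> [|a g h ig ih|g c ig gc] /=.
- by rewrite Rintegral_cst// mul0r.
- rewrite RintegralD//; last exact: (integrableZl _ a ig).
  by rewrite RintegralZl.
- have -> : c = \int[Q]_t (cst c t).
    have QT : fine (Q setT) = 1 by rewrite (probability_setT Q).
    by rewrite Rintegral_cst// QT mulr1.
  exact: (le_Rintegral measurableT ig (icst c)).
Qed.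

End Integral.

Section Average.
Context {R : realType} {T : Type} (n : nat) (index : 'I_n.+1 -> T).

Lemma uniformly_closed_setT : uniformly_closed [set: T -> R].
Proof. by []. Qed.

Lemma mean_functional_average : mean_functional [set: T -> R]
  (fun g => n.+1%:R^-1 * \sum_(i < n.+1) g (index i)).
Proof.
split=> [|a g h _ _|g c _ gc] /=.
- by rewrite big1 ?mulr0.
- by rewrite big_split/= -mulr_sumr; ring.
- rewrite mulrC ler_pdivrMr// (le_trans (ler_sum _ (fun i _ => gc (index i))))//.
  by rewrite sumr_const card_ord mulr_natr.
Qed.

End Average.

Section Objective.
Context {R : realType} {d : nat} {dX : measure_display} {Xi : measurableType dX}
  (F : Xi -> 'rV[R]_d -> R) (f : 'rV[R]_d -> R) (m1 m2 : R -> nat)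
  (nu : forall p : R, probability (sample Xi (m1 p) (m2 p)) R).
Hypothesis f_def : stochastic_objective F f nu.

Lemma measurable_component x : measurable_fun setT (F ^~ x).
Proof.
case: f_def => [n index _ mXi _ _|Q intF _ _].
  by move=> _ B _; exact: mXi.
exact/measurable_EFinP/(measurable_int _ (intF x)).
Qed.

Lemma smooth_objective L1 L2 : 0 <= L1 -> 0 <= L2 ->
  (forall xi, smooth_component L1 L2 (F xi)) -> smooth_component L1 L2 f.
Proof.
move=> L10 L20 smF; case: f_def => [n index _ _ fE _|Q intF fE _].
  exact: (smooth_component_expectation uniformly_closed_setT smF (fun=> Logic.I)
    (mean_functional_average index)).
exact: (smooth_component_expectation (uniformly_closed_integrable Q) smF intF
    (mean_functional_integral Q)).
Qed.

End Objective.

(** * Descent and deterministic termination *)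

Section Descent.
Context {R : realType} {d : nat} (L1 L2 : R) (f : 'rV[R]_d -> R).
Hypotheses (L1_gt0 : 0 < L1) (L2_gt0 : 0 < L2).
Hypothesis f_smooth : smooth_component L1 L2 f.
Implicit Types (x g v : 'rV[R]_d).

(** The error [e] in the gradient costs [e * norm2 g], which is absorbed in half
of the gain [norm2 g ^+ 2 / 2] at the price of [e ^+ 2]. *)
Lemma gradient_step_descent x g e : norm2 (g - grad f x) <= e ->
  f (x - L1^-1 *: g) <= f x - (norm2 g ^+ 2 / (4 * L1) - e ^+ 2 / L1).
Proof.
move=> ge; have i0 : 0 < L1^-1 by rewrite invr_gt0.
have := taylor1 f_smooth x (- (L1^-1 *: g)).
rewrite dotNr dotZr norm2N norm2Z (gtr0_norm i0) ler_norml => /andP[_].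
have : dot (g - grad f x) g <= e * norm2 g.
  by rewrite (le_trans (dot_le_norm2 _ _))// ler_wpM2r ?norm2_ge0.
rewrite dotBl -sqr_norm2 => h1 h2.
have amgm : e * norm2 g <= e ^+ 2 + norm2 g ^+ 2 / 4.
  have := sqr_ge0 (e - norm2 g / 2); lra.
have h3 : L1^-1 * (norm2 g ^+ 2 - dot (grad f x) g) <=
    L1^-1 * (e ^+ 2 + norm2 g ^+ 2 / 4).
  by rewrite ler_pM2l// (le_trans h1).
have e1 : L1 / 2 * (L1^-1 * norm2 g) ^+ 2 = L1^-1 * norm2 g ^+ 2 / 2.
  by field; rewrite gt_eqF.
have e2 : norm2 g ^+ 2 / (4 * L1) = L1^-1 * norm2 g ^+ 2 / 4.
  by field; rewrite gt_eqF.
rewrite e2; move: h2; rewrite e1; lra.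
Qed.

Lemma mul_sign_normr (t : R) : sign t * t = `|t|.
Proof.
rewrite /sign; case: (lerP 0 t) => t0; first by rewrite mul1r ger0_norm.
by rewrite mulN1r ltr0_norm.
Qed.

Lemma normr_sign (t : R) : `|sign t| = 1.
Proof. by rewrite /sign; case: ifP; rewrite ?normrN1 ?normr1. Qed.

(** The sign makes the slope along the step nonpositive for the sampled
gradient, so the first-order term is at most the error of that gradient. *)
Lemma curvature_step_descent x g (H : 'M[R]_d) v e3 e4 eta : 0 <= eta ->
  norm2 v = 1 -> spectral_norm (H - hess f x) <= e3 ->
  norm2 (g - grad f x) <= e4 ->
  f (x - (eta * sign (dot v g)) *: v) <=
  f x + eta * e4 + eta ^+ 2 / 2 * (quad H v + e3) + L2 / 6 * eta ^+ 3.
Proof.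
move=> eta0 v1 He ge; have := taylor2_le f_smooth x (- ((eta * sign (dot v g)) *: v)).
rewrite -scaleNr quadZ norm2Z dotZr v1 mulr1 normrN normrM (ger0_norm eta0).
rewrite normr_sign mulr1 sqrrN exprMn.
have -> : sign (dot v g) ^+ 2 = 1.
  by rewrite -[LHS]real_normK ?num_real// normr_sign expr1n.
rewrite mulr1 => /le_trans; apply.
rewrite lerD2r -addrA -addrA lerD2l.
have hq : quad (hess f x) v <= quad H v + e3.
  have := quad_le (H - hess f x) v; rewrite v1 expr1n mulr1 quadB ler_norml.
  by move=> /andP[q _]; have := le_trans q; lra.
rewrite lerD//; last first.
  by rewrite mulrAC ler_wpM2l// ?mulr_ge0 ?sqr_ge0.
rewrite mulNr -mulrN -mulrA ler_wpM2l// mulrN.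
have -> : dot (grad f x) v = dot v g - dot (g - grad f x) v.
  by rewrite dotBl (dotC g) opprB addrC subrK.
rewrite mulrBr mul_sign_normr opprB.
rewrite (le_trans (_ : _ <= `|sign (dot v g) * dot (g - grad f x) v|))//.
  by rewrite lerBlDr (le_trans (ler_norm _))// lerDl.
rewrite normrM normr_sign mul1r (le_trans (cauchy_schwarz _ _))// v1 mulr1//.
Qed.

End Descent.

(** The largest tolerances that the sampling assumption allows.  Unlike the
[eps3] and [eps4] chosen at each point, they do not depend on [x], which makes
the event measurable jointly in the point and the sample. *)
Definition accurate_sample {R : realType} {d : nat} {Xi : Type}
    (F : Xi -> 'rV[R]_d -> R) (f : 'rV[R]_d -> R) (L2 eps1 eps2 : R)
    {m1 m2 : nat} (x : 'rV[R]_d) (S1 : m1.-tuple Xi) (S2 : m2.-tuple Xi) :=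
  spectral_norm (sub_hess F S2 x - hess f x) <= eps2 / 24 /\
  norm2 (sub_grad F S1 x - grad f x) <=
    Num.min ((2 * Num.sqrt 2)^-1 * eps1) (eps2 ^+ 2 / (24 * L2)).

Lemma pca_input_sample {R : realType} {d m : nat} {Xi : Type}
    (F : Xi -> 'rV[R]_d -> R) (L1 L2 eps p : R) (S : m.-tuple Xi) x :
  (0 < d)%N -> (0 < m)%N -> 0 < L1 -> 0 < L2 -> 0 < eps -> 0 < p < 1 ->
  (forall xi, smooth_component L1 L2 (F xi)) ->
  pca_input L1 (sample_hess F S x) eps p.
Proof.
move=> d0 m0 L10 L20 e0 p01 smF; split=> // i; split.
  exact: (hess_sym (smF _) _ (ltW L20)).
exact: (spectral_norm_hess_le (smF _) _ (ltW L10)).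
Qed.

Section Iteration.
Context {R : realType} {A : approx_pca R} {d : nat} {dX : measure_display}
  {Xi : measurableType dX} (F : Xi -> 'rV[R]_d -> R) (f : 'rV[R]_d -> R)
  {m1 m2 : nat} (L1 L2 eps1 alpha p : R) (x0 : 'rV[R]_d).
Hypotheses (d_gt0 : (0 < d)%N) (m2_gt0 : (0 < m2)%N) (L1_gt0 : 0 < L1)
  (L2_gt0 : 0 < L2) (eps1_gt0 : 0 < eps1) (p_range : 0 < p < 1).
Hypothesis F_smooth : forall xi, smooth_component L1 L2 (F xi).
Hypothesis f_smooth : smooth_component L1 L2 f.

Let eps2 := sncg_eps2 eps1 alpha.
Let step := sncg_step (A := A) (m1 := m1) (m2 := m2) F L1 L2 eps1 alpha p.
Let iterate := sncg_iterate (A := A) (m1 := m1) (m2 := m2) F L1 L2 eps1 alpha p x0.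
Let stops := sncg_stops (A := A) (m1 := m1) (m2 := m2) F L1 L2 eps1 alpha p x0.

Lemma eps2_gt0 : 0 < eps2.
Proof. exact: powR_gt0. Qed.

Lemma sncg_pca_accuracy_gt0 x (w : draw A Xi m1 m2) :
  0 < sncg_pca_accuracy F eps1 alpha x w.
Proof. by rewrite divr_gt0// lt_max eps2_gt0. Qed.

Lemma norm2_sncg_direction x w : norm2 (step x w).2 = 1.
Proof.
apply/pca_unit/(pca_input_sample _ _ _ _ L1_gt0 L2_gt0) => //.
exact: sncg_pca_accuracy_gt0.
Qed.

Let rate := sncg_rate L1 L2 eps1 eps2.

Lemma sncg_rate_gt0 : 0 < rate.
Proof.
by rewrite lt_max; apply/orP; left; rewrite divr_gt0 ?mulr_gt0 ?exprn_gt0 ?eps2_gt0.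
Qed.

(** The step follows whichever direction has the larger guaranteed decrease, and
the accuracy of the samples turns both guarantees into actual decreases of [f].
A step that does not stop has a guarantee of at least [rate^-1]: from the
curvature if the stopping test fails on the curvature, from the gradient if it
fails on the gradient. *)
Lemma sncg_step_descent x (w : draw A Xi m1 m2) :
  accurate_sample F f L2 eps1 eps2 x w.1.1 w.1.2 ->
  quad (sub_hess F w.1.2 x) (step x w).2 <= - (eps2 / 2) \/
    eps1 < norm2 (sub_grad F w.1.1 x) ->
  f (step x w).1 <= f x - rate^-1.
Proof.
move=> [accH]; rewrite le_min => /andP[accg1 accg2] big.
have e20 := eps2_gt0.
set g := sub_grad F w.1.1 x in accg1 accg2 big *.
set H := sub_hess F w.1.2 x in accH big *.
set v := (step x w).2 in big *.
have v1 : norm2 v = 1 by exact: norm2_sncg_direction.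
pose curv := - (eps2 ^+ 2 / (2 * L2 ^+ 2)) * quad H v - 11 * eps2 ^+ 3 / (48 * L2 ^+ 2).
pose slope := norm2 g ^+ 2 / (4 * L1) - eps1 ^+ 2 / (8 * L1).
have stepE : (step x w).1 = if curv > slope
    then x - (eps2 / L2 * sign (dot v g)) *: v else x - L1^-1 *: g by [].
have fcurv : f (x - (eps2 / L2 * sign (dot v g)) *: v) <= f x - curv.
  have eta0 : 0 <= eps2 / L2 by rewrite divr_ge0 ?ltW.
  have := curvature_step_descent f_smooth eta0 v1 accH accg2.
  move=> /le_trans; apply; rewrite le_eqVlt; apply/orP; left; apply/eqP.
  by rewrite /curv; field; rewrite gt_eqF.
have fslope : f (x - L1^-1 *: g) <= f x - slope.
  have := gradient_step_descent L1_gt0 f_smooth accg1.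
  move=> /le_trans; apply; rewrite le_eqVlt; apply/orP; left; apply/eqP.
  have s2 : Num.sqrt 2 ^+ 2 = 2 :> R by rewrite sqr_sqrtr.
  rewrite /slope exprMn exprVn exprMn s2; by field; rewrite gt_eqF.
have fmax : f (step x w).1 <= f x - Num.max curv slope.
  rewrite stepE; case: ifPn => [cs|]; first by rewrite (max_l (ltW cs)).
  by rewrite -leNgt => cs; rewrite (max_r cs).
apply: (le_trans fmax); rewrite lerD2l lerN2 le_max.
have rV b : 0 < b -> b <= rate -> rate^-1 <= b^-1.
  by move=> b0 br; rewrite lef_pV2 ?posrE ?sncg_rate_gt0.
case: big => [qv|ng]; apply/orP; [left|right].
  have := rV (48 * L2 ^+ 2 / eps2 ^+ 3).
  rewrite divr_gt0 ?mulr_gt0 ?exprn_gt0// le_max lexx => /(_ isT isT)/le_trans; apply.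
  have c0 : 0 < eps2 ^+ 2 / (2 * L2 ^+ 2) by rewrite divr_gt0 ?mulr_gt0 ?exprn_gt0.
  have := ler_wpM2l (ltW c0) qv.
  have -> : (48 * L2 ^+ 2 / eps2 ^+ 3)^-1 =
     eps2 ^+ 2 / (2 * L2 ^+ 2) * (eps2 / 2) - 11 * eps2 ^+ 3 / (48 * L2 ^+ 2).
    by field; rewrite !gt_eqF.
  rewrite /curv; lra.
have := rV (8 * L1 / eps1 ^+ 2).
rewrite divr_gt0 ?mulr_gt0 ?exprn_gt0// le_max lexx orbT => /(_ isT isT)/le_trans; apply.
have g2 : eps1 ^+ 2 <= norm2 g ^+ 2 by rewrite ler_sqr ?nnegrE ?norm2_ge0// ltW.
have -> : (8 * L1 / eps1 ^+ 2)^-1 = eps1 ^+ 2 / (4 * L1) - eps1 ^+ 2 / (8 * L1).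
  by field; rewrite !gt_eqF.
by rewrite lerD2r ler_wpM2r// invr_ge0 mulr_ge0// ltW.
Qed.

Section Run.
Variable w : nat -> draw A Xi m1 m2.

Lemma iterate_descent k :
  (forall i, (i < k)%N ->
    accurate_sample F f L2 eps1 eps2 (iterate w i) (w i).1.1 (w i).1.2) ->
  (forall i, (i < k)%N -> ~ stops w i) ->
  f (iterate w k) <= f x0 - k%:R / rate.
Proof.
elim: k => [|k ih] acc nostop; first by rewrite mul0r subr0.
have := ih (fun i ik => acc i (ltnW ik)) (fun i ik => nostop i (ltnW ik)).
have : f (iterate w k.+1) <= f (iterate w k) - rate^-1.
  apply: sncg_step_descent; first exact: acc.
  apply: contrapT => /not_orP[/negP + /negP]; rewrite -ltNge -leNgt => q g.
  by apply: (nostop k).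
rewrite -natr1 mulrDl mul1r; lra.
Qed.

(** [K] steps without a stop would bring [f] below its minimum. *)
Lemma terminates_within K xstar Delta :
  (forall x, f xstar <= f x) -> f x0 - f xstar <= Delta ->
  (forall i, (i < K)%N ->
    accurate_sample F f L2 eps1 eps2 (iterate w i) (w i).1.1 (w i).1.2) ->
  rate * Delta < K%:R ->
  exists2 k, (k < K)%N &
    sncg_terminates_at F L1 L2 eps1 alpha p x0 w k.
Proof.
move=> xmin gap acc KD.
have [|nostop] := pselect (exists i, (i < K)%N && `[< stops w i >]).
  move=> /ex_minnP[k /andP[kK /asboolP sk] kmin]; exists k => //; split=> // i ik si.
  have /kmin : (i < K)%N && `[< stops w i >].
    by rewrite (ltn_trans ik kK)/=; exact/asboolP.
  by rewrite leqNgt ik.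
have nostopi i : (i < K)%N -> ~ stops w i.
  by move=> iK si; apply: nostop; exists i; rewrite iK; exact/asboolP.
have := iterate_descent acc nostopi; rewrite leNgt => /negP[].
rewrite (lt_le_trans _ (xmin _))// ltrBlDr -ltrBlDl (le_lt_trans gap)//.
by rewrite ltr_pdivlMr ?sncg_rate_gt0// mulrC.
Qed.

(** At a stop the sampled gradient is at most [eps1], so the curvature along the
computed direction exceeds the smallest eigenvalue of the sampled Hessian by at
most [eps2 / 2]; with the curvature test this eigenvalue is at least [- eps2],
and the sampling errors fit in the remaining slack. *)
Lemma termination_guarantee k :
  accurate_sample F f L2 eps1 eps2 (iterate w k) (w k).1.1 (w k).1.2 ->
  quad (sub_hess F (w k).1.2 (iterate w k)) (step (iterate w k) (w k)).2 -
     sncg_pca_accuracy F eps1 alpha (iterate w k) (w k) <=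
  lambda_min (sub_hess F (w k).1.2 (iterate w k)) ->
  0 < alpha <= 1 -> stops w k ->
  norm2 (grad f (iterate w k)) <= 2 * eps1 /\
  - (2 * eps2) <= lambda_min (hess f (iterate w k)).
Proof.
set x := iterate w k; set H := sub_hess _ _ _; set g := sub_grad F (w k).1.1 x.
move=> [accH]; rewrite le_min => /andP[accg _] pca alpha_range [qH].
rewrite -/x -/g => ge.
have e20 := eps2_gt0; split.
  have -> : grad f x = g - (g - grad f x) by rewrite opprB addrC subrK.
  rewrite (le_trans (norm2_triangle _ _))// norm2N mulr_natl mulr2n lerD//.
  rewrite (le_trans accg)// ler_piMl ?(ltW eps1_gt0)// invf_le1 ?mulr_gt0 ?sqrtr_gt0//.
  have : 1 <= Num.sqrt 2 :> R by rewrite -{1}sqrtr1 ler_wsqrtr// ler1n.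
  lra.
have fsym : (hess f x)^T = hess f x := hess_sym f_smooth x (ltW L2_gt0).
have Hsym : H^T = H.
  rewrite /H /sub_hess /mean_mx linearZ linear_sum/=; congr (_ *: _).
  by apply: eq_bigr => i _; exact: (hess_sym (F_smooth _) _ (ltW L2_gt0)).
have acc_le : sncg_pca_accuracy F eps1 alpha x (w k) <= eps2 / 2.
  rewrite ler_wpM2r// ge_max lexx/= ge0_ler_powR ?nnegrE ?norm2_ge0 ?(ltW eps1_gt0)//.
  by have /andP[/ltW] := alpha_range.
have lH : - eps2 <= lambda_min H.
  apply: le_trans pca; rewrite -/x in qH; move: qH; rewrite -/step -/H -/eps2.
  set q := quad _ _; lra.
apply/(lambda_min_geP _ d_gt0 fsym) => u.
have := (lambda_min_geP _ d_gt0 Hsym).1 lH u.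
have := quad_le (H - hess f x) u; rewrite quadB ler_norml => /andP[_].
have := ler_wpM2r (sqr_ge0 (norm2 u)) accH.
have := mulr_ge0 (ltW e20) (sqr_ge0 (norm2 u)); lra.
Qed.

End Run.
End Iteration.

(** * Measurability along the iterates *)

Lemma rational_row_dense {R : realType} {d : nat} (u : 'rV[R]_d) (e : R) : 0 < e ->
  exists q : 'rV[rat]_d, `|u - map_mx ratr q| < e.
Proof.
move=> e0.
have /choice[q qP] : forall i, exists r : rat, `|u 0 i - ratr r| < e / 2.
  move=> i; have : u 0 i - e / 2 < u 0 i + e / 2 by lra.
  move=> /rat_in_itvoo[r]; rewrite in_itv/= => /andP[r1 r2]; exists r.
  by rewrite ltr_norml; apply/andP; split; lra.
exists (\row_i q i); apply: (@le_lt_trans _ _ (e / 2)); last lra.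
rewrite [`|_|]mx_normrE; apply: bigmax_le => [|[i j] _]/=; first lra.
by rewrite ord1 !mxE ltW.
Qed.

Definition measurable_row {R : realType} {dT : measure_display}
    {T : measurableType dT} {d : nat} (y : T -> 'rV[R]_d) : Prop :=
  forall i, measurable_fun setT (fun t => y t 0 i).

Definition measurable_matrix {R : realType} {dT : measure_display}
    {T : measurableType dT} {d : nat} (M : T -> 'M[R]_d) : Prop :=
  forall i j, measurable_fun setT (fun t => M t i j).

Section MeasurableRows.
Context {R : realType} {dT : measure_display} {T : measurableType dT} {d : nat}.
Implicit Types (y z : T -> 'rV[R]_d) (M N : T -> 'M[R]_d) (c : T -> R).

Lemma measurable_fun_eq_ext (g h : T -> R) :
  measurable_fun setT h -> g =1 h -> measurable_fun setT g.
Proof. by move=> mh /funext ->. Qed.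

Lemma measurable_dot y z : measurable_row y -> measurable_row z ->
  measurable_fun setT (fun t => dot (y t) (z t)).
Proof.
move=> my mz; apply: (measurable_fun_eq_ext (h := fun t => \sum_i y t 0 i * z t 0 i)).
  by apply: measurable_sum => i; exact: measurable_funM.
by move=> t; rewrite dotE.
Qed.

Lemma measurable_norm2 y : measurable_row y -> measurable_fun setT (fun t => norm2 (y t)).
Proof.
move=> my; apply: (@measurableT_comp _ _ _ _ _ _ (@Num.sqrt R));
  last exact: measurable_dot.
by apply: continuous_measurable_fun; exact: sqrt_continuous.
Qed.

Lemma measurable_row_cst (u : 'rV[R]_d) : measurable_row (fun _ : T => u).
Proof. by move=> i; exact: measurable_cst. Qed.

Lemma measurable_rowZ c y : measurable_fun setT c -> measurable_row y ->
  measurable_row (fun t => c t *: y t).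
Proof.
move=> mc my i; apply: (measurable_fun_eq_ext (h := fun t => c t * y t 0 i)).
  exact: measurable_funM.
by move=> t; rewrite mxE.
Qed.

Lemma measurable_rowB y z : measurable_row y -> measurable_row z ->
  measurable_row (fun t => y t - z t).
Proof.
move=> my mz i; apply: (measurable_fun_eq_ext (h := fun t => y t 0 i - z t 0 i)).
  exact: measurable_funB.
by move=> t; rewrite !mxE.
Qed.

Lemma measurable_row_sum n (y : 'I_n -> T -> 'rV[R]_d) :
  (forall k, measurable_row (y k)) ->
  measurable_row (fun t => \sum_k y k t).
Proof.
move=> my i; apply: (measurable_fun_eq_ext (h := fun t => \sum_k y k t 0 i)).
  by apply: measurable_sum => k; exact: my.
by move=> t; rewrite summxE.
Qed.

Lemma measurable_mulmx M y : measurable_matrix M -> measurable_row y ->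
  measurable_row (fun t => y t *m M t).
Proof.
move=> mM my j; apply: (measurable_fun_eq_ext (h := fun t => \sum_i y t 0 i * M t i j)).
  by apply: measurable_sum => i; exact: measurable_funM.
by move=> t; rewrite mxE.
Qed.

Lemma measurable_quad M y : measurable_matrix M -> measurable_row y ->
  measurable_fun setT (fun t => quad (M t) (y t)).
Proof. by move=> mM my; apply: measurable_dot => //; exact: measurable_mulmx. Qed.

(** Continuity of the form reduces the universal quantifier to the countably
many rational directions.  Bounds on the spectral norm and on the smallest
eigenvalue are instances. *)
Lemma measurable_quad_ge0 M : measurable_matrix M ->
  measurable [set t | forall u, 0 <= quad (M t) u].
Proof.
move=> mM.
have -> : [set t | forall u, 0 <= quad (M t) u] =
    ~` \bigcup_(q : 'rV[rat]_d) [set t | quad (M t) (map_mx ratr q) < 0].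
  apply/seteqP; split=> t /=.
    by move=> pos [q _] /=; rewrite ltNge pos.
  move=> nneg u; rewrite leNgt; apply/negP => neg; apply: nneg.
  have /nbhs_ballP[e /= e0 eP] : \forall v \near u, quad (M t) v < 0.
    exact: (cvgr_lt _ (@continuous_quad _ _ (M t) u)).
  have [q uq] := rational_row_dense u e0; exists q => //=.
  by apply: eP; rewrite -ball_normE.
apply: measurableC; apply: countable_bigcupT_measurable => [|q].
  exact: countableP.
rewrite -[X in measurable X]setTI.
have mq : measurable_fun setT (fun t => quad (M t) (map_mx ratr q) < 0).
  apply: measurable_fun_ltr; last exact: measurable_cst.
  by apply: measurable_quad => //; exact: measurable_row_cst.
exact: (mq measurableT [set true]).
Qed.

Lemma measurable_matrixB M N : measurable_matrix M -> measurable_matrix N ->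
  measurable_matrix (fun t => M t - N t).
Proof.
move=> mM mN i j; apply: (measurable_fun_eq_ext (h := fun t => M t i j - N t i j)).
  exact: measurable_funB.
by move=> t; rewrite !mxE.
Qed.

Lemma measurable_scalar_mx c : measurable_fun setT c ->
  measurable_matrix (fun t => (c t)%:M : 'M[R]_d).
Proof.
move=> mc i j; apply: (measurable_fun_eq_ext (h := fun t => c t *+ (i == j))).
  by case: (i == j) => //; exact: measurable_cst.
by move=> t; rewrite mxE.
Qed.

(** [spectral_norm M <= e] says that [e ^+ 2 - M^T *m M] is a nonnegative
form. *)
Lemma measurable_spectral_norm_le M (e : R) : 0 <= e -> measurable_matrix M ->
  measurable [set t | spectral_norm (M t) <= e].
Proof.
move=> e0 mM.
have gram (N : 'M[R]_d) u : quad ((e ^+ 2)%:M - N^T *m N) u =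
    e ^+ 2 * norm2 u ^+ 2 - norm2 (u *m N^T) ^+ 2.
  rewrite quadB; congr (_ - _); first by rewrite quadE mul_mx_scalar dotZl sqr_norm2.
  by rewrite sqr_norm2 quadE mulmxA dot_mulmxl.
rewrite (_ : [set t | _] =
    [set t | forall u, 0 <= quad ((e ^+ 2)%:M - (M t)^T *m M t) u]).
  apply: measurable_quad_ge0; apply: measurable_matrixB.
    by apply: measurable_scalar_mx; exact: measurable_cst.
  move=> i j; apply: (measurable_fun_eq_ext (h := fun t => \sum_k M t k i * M t k j)).
    by apply: measurable_sum => k; exact: measurable_funM.
  by move=> t; rewrite mxE; apply: eq_bigr => k _; rewrite mxE.
have sq u (N : 'M[R]_d) : (0 <= quad ((e ^+ 2)%:M - N^T *m N) u) =
    (norm2 (u *m N^T) <= e * norm2 u).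
  rewrite gram subr_ge0 -exprMn ler_sqr ?nnegrE ?norm2_ge0//.
  by rewrite mulr_ge0 ?norm2_ge0.
apply/seteqP; split=> t /= h => [u|].
  by rewrite sq (le_trans (norm2_mulmx_tr_le _ _))// ler_wpM2r ?norm2_ge0.
apply: spectral_norm_le => // u v; rewrite dot_mulmxl.
rewrite (le_trans (dot_le_norm2 _ _))// mulrAC mulrC ler_wpM2r ?norm2_ge0//.
by have := h v; rewrite sq.
Qed.

Lemma measurable_lambda_min_ge M c : (0 < d)%N -> (forall t, (M t)^T = M t) ->
  measurable_matrix M -> measurable_fun setT c ->
  measurable [set t | c t <= lambda_min (M t)].
Proof.
move=> d0 sM mM mc.
rewrite (_ : [set t | _] = [set t | forall u, 0 <= quad (M t - (c t)%:M) u]).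
  by apply/measurable_quad_ge0/measurable_matrixB => //; exact: measurable_scalar_mx.
have sq t u : (0 <= quad (M t - (c t)%:M) u) = (c t * norm2 u ^+ 2 <= quad (M t) u).
  by rewrite quadB [quad _%:M u]quadE mul_mx_scalar dotZl subr_ge0 sqr_norm2.
apply/seteqP; split=> t /=.
  by move=> /(lambda_min_geP _ d0 (sM t)) h u; rewrite sq.
by move=> h; apply/(lambda_min_geP _ d0 (sM t)) => u; rewrite -sq.
Qed.

(** A function that is measurable in a parameter and Lipschitz in the point,
uniformly in the parameter, is the infimum over rational points [q] of
[G xi q + K * norm2 (x - q)]; so it is jointly measurable along any measurable
choice of both arguments. *)
Lemma measurable_lipschitz_comp {dX : measure_display} {Xi : measurableType dX}
    (G : Xi -> 'rV[R]_d -> R) (K : R) (s : T -> Xi) y : 0 <= K ->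
  (forall x, measurable_fun setT (G ^~ x)) ->
  (forall xi x x', G xi x <= G xi x' + K * norm2 (x - x')) ->
  measurable_fun setT s -> measurable_row y ->
  measurable_fun setT (fun t => G (s t) (y t)).
Proof.
move=> K0 mG lipG ms my.
move=> mT; apply: (measurability _ (RGenInftyO.measurableE R)) => // _ [_ [a ->] <-].
rewrite setTI.
have -> : (fun t => G (s t) (y t)) @^-1` `]-oo, a[ =
  \bigcup_(q : 'rV[rat]_d)
    [set t | G (s t) (map_mx ratr q) + K * norm2 (y t - map_mx ratr q) < a].
  apply/seteqP; split=> t /=; last first.
    by move=> [q _] /=; rewrite in_itv/=; exact: le_lt_trans.
  rewrite in_itv/= => Ga.
  (* For q at distance n from y t, G (s t) q + K n exceeds G (s t) (y t) by at
     most 2 K n; the factor sqrt d converts from the sup norm, in which rational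
     points are chosen. *)
  pose D := 2 * K * Num.sqrt d%:R + 1.
  have D0 : 0 < D by rewrite ltr_wpDl// !mulr_ge0// sqrtr_ge0.
  have e0 : 0 < (a - G (s t) (y t)) / D by rewrite divr_gt0// subr_gt0.
  have [q uq] := rational_row_dense (y t) e0; exists q => //=.
  have h1 := lipG (s t) (map_mx ratr q) (y t); rewrite norm2_distC in h1.
  have h2 := norm2_le_normr (y t - map_mx ratr q).
  set n := norm2 _ in h1 h2 *.
  have h3 : K * n <= K * (Num.sqrt d%:R * `|y t - map_mx ratr q|) by rewrite ler_wpM2l.
  rewrite ltr_pdivlMr// in uq.
  have := normr_ge0 (y t - map_mx ratr q).
  move: uq; rewrite /D; lra.
apply: countable_bigcupT_measurable => [|q]; first exact: countableP.
have mq : measurable_fun setT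
    (fun t => G (s t) (map_mx ratr q) + K * norm2 (y t - map_mx ratr q) < a).
  apply: measurable_fun_ltr; last exact: measurable_cst.
  apply: measurable_funD; first exact: (measurableT_comp (mG _)).
  apply: measurable_funM; first exact: measurable_cst.
  by apply/measurable_norm2/measurable_rowB => //; exact: measurable_row_cst.
rewrite -[X in measurable X]setTI; exact: (mq measurableT [set true]).
Qed.

End MeasurableRows.

Section SmoothCoordinates.
Context {R : realType} {d : nat} (L1 L2 : R) (f : 'rV[R]_d -> R).
Hypothesis f_smooth : smooth_component L1 L2 f.

Lemma grad_coord_lipschitz x x' i :
  grad f x 0 i <= grad f x' 0 i + L1 * norm2 (x - x').
Proof.
have [_ lip _] := f_smooth; rewrite -lerBlDl.
have sub_entry (u v : 'rV[R]_d) : u 0 i - v 0 i = (u - v) 0 i by rewrite !mxE.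
rewrite sub_entry.
apply: le_trans (ler_norm _) _.
exact: le_trans (normr_coord_le_norm2 _ _) (lip _ _).
Qed.

Lemma hess_entry_lipschitz x x' i j :
  hess f x i j <= hess f x' i j + L2 * norm2 (x - x').
Proof.
rewrite -lerBlDl.
have sub_entry (M N : 'M[R]_d) : M i j - N i j = (M - N) i j by rewrite !mxE.
have := hess_lipschitz_dot f_smooth x x' (delta_mx 0 i) (delta_mx 0 j).
by rewrite !norm2_delta !mulr1 dot_delta -rowE [row _ _ 0 j]mxE sub_entry.
Qed.

End SmoothCoordinates.

Section MeasurableAlgorithm.
Context {R : realType} {A : approx_pca R} {d : nat} {dX : measure_display}
  {Xi : measurableType dX} (F : Xi -> 'rV[R]_d -> R) (f : 'rV[R]_d -> R)
  {m1 m2 : nat} (L1 L2 eps1 alpha p : R) (x0 : 'rV[R]_d).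
Hypotheses (L1_ge0 : 0 <= L1) (L2_ge0 : 0 <= L2).
Hypothesis F_smooth : forall xi, smooth_component L1 L2 (F xi).
Hypothesis f_smooth : smooth_component L1 L2 f.
Hypothesis F_measurable : forall x, measurable_fun setT (F ^~ x).
Context {dT : measure_display} {T : measurableType dT}.

Lemma measurable_grad_comp (s : T -> Xi) y : measurable_fun setT s ->
  measurable_row y -> measurable_row (fun t => grad (F (s t)) (y t)).
Proof.
move=> ms my i.
apply: (measurable_lipschitz_comp (G := fun xi x => grad (F xi) x 0 i) L1_ge0) => //.
- by move=> x; apply: (grad_closed uniformly_closed_measurable F_smooth F_measurable).
- by move=> xi x x'; exact: (grad_coord_lipschitz (F_smooth xi)).
Qed.

Lemma measurable_hess_comp (s : T -> Xi) y : measurable_fun setT s ->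
  measurable_row y -> measurable_matrix (fun t => hess (F (s t)) (y t)).
Proof.
move=> ms my i j.
apply: (measurable_lipschitz_comp (G := fun xi x => hess (F xi) x i j) L2_ge0) => //.
- by move=> x; apply: (hess_closed uniformly_closed_measurable F_smooth F_measurable).
- by move=> xi x x'; exact: (hess_entry_lipschitz (F_smooth xi)).
Qed.

Lemma measurable_grad y : measurable_row y ->
  measurable_row (fun t : T => grad f (y t)).
Proof.
move=> my i.
apply: (measurable_lipschitz_comp (G := fun (t : T) x => grad f x 0 i) L1_ge0
  _ _ (@measurable_id _ T setT)) => //.
by move=> _ x x'; exact: (grad_coord_lipschitz f_smooth).
Qed.

Lemma measurable_hess y : measurable_row y ->
  measurable_matrix (fun t : T => hess f (y t)).
Proof.
move=> my i j.
apply: (measurable_lipschitz_comp (G := fun (t : T) x => hess f x i j) L2_ge0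
  _ _ (@measurable_id _ T setT)) => //.
by move=> _ x x'; exact: (hess_entry_lipschitz f_smooth).
Qed.

Section Samples.
Context (y : T -> 'rV[R]_d) (w : T -> draw A Xi m1 m2).
Hypotheses (y_measurable : measurable_row y) (w_measurable : measurable_fun setT w).

Lemma measurable_tnth_comp n (S : T -> n.-tuple Xi) i : measurable_fun setT S ->
  measurable_fun setT (fun t => tnth (S t) i).
Proof. by move=> mS; exact: (measurableT_comp (measurable_tnth i) mS). Qed.

Lemma measurable_draw : [/\ measurable_fun setT (fun t => (w t).1.1),
  measurable_fun setT (fun t => (w t).1.2) & measurable_fun setT (fun t => (w t).2)].
Proof.
have m1w : measurable_fun setT (fun t => (w t).1).
  exact: (measurableT_comp measurable_fst w_measurable).
split.
- exact: (measurableT_comp measurable_fst m1w).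
- exact: (measurableT_comp measurable_snd m1w).
- exact: (measurableT_comp measurable_snd w_measurable).
Qed.

Lemma measurable_sub_grad : measurable_row (fun t => sub_grad F (w t).1.1 (y t)).
Proof.
have [mS _ _] := measurable_draw.
apply: measurable_rowZ; first exact: measurable_cst.
apply: measurable_row_sum => i; apply: measurable_grad_comp => //.
exact: measurable_tnth_comp.
Qed.

Lemma measurable_sample_hess i :
  measurable_matrix (fun t => sample_hess F (w t).1.2 (y t) i).
Proof.
have [_ mS _] := measurable_draw.
by apply: measurable_hess_comp => //; exact: measurable_tnth_comp.
Qed.

Lemma measurable_sub_hess : measurable_matrix (fun t => sub_hess F (w t).1.2 (y t)).
Proof.
move=> a b; apply: (measurable_fun_eq_ext (h := fun t =>
    m2%:R^-1 * \sum_(i < m2) sample_hess F (w t).1.2 (y t) i a b)).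
  apply: measurable_funM; first exact: measurable_cst.
  by apply: measurable_sum => i; exact: measurable_sample_hess.
have entry (c : R) (H : 'I_m2 -> 'M[R]_d) :
    (c *: \sum_i H i) a b = c * \sum_i H i a b by rewrite mxE summxE.
by move=> t; exact: entry.
Qed.

Lemma measurable_pca_accuracy :
  measurable_fun setT (fun t => sncg_pca_accuracy F eps1 alpha (y t) (w t)).
Proof.
apply: measurable_funM; last exact: measurable_cst.
apply: measurable_maxr; first exact: measurable_cst.
apply: (@measurableT_comp _ _ _ _ _ _ (fun r : R => r `^ alpha)).
  exact: measurable_powR.
by apply: measurable_norm2; exact: measurable_sub_grad.
Qed.

Let step t := sncg_step F L1 L2 eps1 alpha p (y t) (w t).

Lemma measurable_direction : measurable_row (fun t => (step t).2).
Proof.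
have [_ _ mz] := measurable_draw.
move=> b; apply: (@pca_measurable R A d m2 L1 p dT T
  (fun t => sample_hess F (w t).1.2 (y t))
  (fun t => sncg_pca_accuracy F eps1 alpha (y t) (w t)) (fun t => (w t).2)) => //.
- by move=> i a c; exact: measurable_sample_hess.
- exact: measurable_pca_accuracy.
Qed.

Lemma measurable_sign (g : T -> R) : measurable_fun setT g ->
  measurable_fun setT (fun t => sign (g t)).
Proof.
move=> mg; apply: measurable_fun_ifT; try exact: measurable_cst.
by apply: measurable_fun_ler => //; exact: measurable_cst.
Qed.

Lemma measurable_sncg_step : measurable_row (fun t => (step t).1).
Proof.
have mg := measurable_sub_grad; have mv := measurable_direction.
have mH := measurable_sub_hess.
pose g t := sub_grad F (w t).1.1 (y t); pose e2 := sncg_eps2 eps1 alpha.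
move=> i; pose b t := norm2 (g t) ^+ 2 / (4 * L1) - eps1 ^+ 2 / (8 * L1) <
  - (e2 ^+ 2 / (2 * L2 ^+ 2)) * quad (sub_hess F (w t).1.2 (y t)) (step t).2
  - 11 * e2 ^+ 3 / (48 * L2 ^+ 2).
apply: (measurable_fun_eq_ext (h := fun t => if b t
    then (y t - (e2 / L2 * sign (dot (step t).2 (g t))) *: (step t).2) 0 i
    else (y t - L1^-1 *: g t) 0 i)); last first.
  by move=> t; rewrite /step/= /b; case: ifP.
have mcst (c : R) : measurable_fun setT (fun _ : T => c) by exact: measurable_cst.
apply: measurable_fun_ifT.
- apply: measurable_fun_ltr; apply: measurable_funB => //; apply: measurable_funM => //.
    by apply: measurable_funX; exact: measurable_norm2.
  exact: measurable_quad.
- apply: measurable_rowB => //; apply: measurable_rowZ => //.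
  apply: measurable_funM => //; apply: measurable_sign; exact: measurable_dot.
- by apply: measurable_rowB => //; exact: measurable_rowZ.
Qed.

Lemma measurable_accurate_sample eps2 : 0 <= eps2 ->
  measurable [set t | accurate_sample F f L2 eps1 eps2 (y t) (w t).1.1 (w t).1.2].
Proof.
move=> e20; apply: measurableI.
  apply: measurable_spectral_norm_le; first by rewrite divr_ge0.
  by apply: measurable_matrixB; [exact: measurable_sub_hess|exact: measurable_hess].
rewrite -[X in measurable X]setTI.
have mle : measurable_fun setT (fun t =>
    norm2 (sub_grad F (w t).1.1 (y t) - grad f (y t)) <=
    Num.min ((2 * Num.sqrt 2)^-1 * eps1) (eps2 ^+ 2 / (24 * L2))).
  apply: measurable_fun_ler; last exact: measurable_cst.
  apply/measurable_norm2/measurable_rowB; first exact: measurable_sub_grad.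
  exact: measurable_grad.
exact: (mle measurableT [set true]).
Qed.

Lemma measurable_pca_accurate : (0 < d)%N ->
  measurable [set t |
    quad (sub_hess F (w t).1.2 (y t)) (step t).2 -
      sncg_pca_accuracy F eps1 alpha (y t) (w t)
    <= lambda_min (sub_hess F (w t).1.2 (y t))].
Proof.
move=> d0; apply: measurable_lambda_min_ge => //.
- move=> t; rewrite /sub_hess /mean_mx linearZ linear_sum/=; congr (_ *: _).
  by apply: eq_bigr => i _; exact: (hess_sym (F_smooth _) _ L2_ge0).
- exact: measurable_sub_hess.
- apply: measurable_funB; last exact: measurable_pca_accuracy.
  by apply: measurable_quad; [exact: measurable_sub_hess|exact: measurable_direction].
Qed.

End Samples.

Lemma measurable_iterate (draws : T -> nat -> draw A Xi m1 m2) k :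
  (forall i, (i < k)%N -> measurable_fun setT (fun t => draws t i)) ->
  measurable_row (fun t => sncg_iterate F L1 L2 eps1 alpha p x0 (draws t) k).
Proof.
elim: k => [|k ih] md /=; first exact: measurable_row_cst.
apply: measurable_sncg_step; last exact: md.
by apply: ih => i ik; exact/md/ltnW.
Qed.

End MeasurableAlgorithm.

(** * Independence of a draw from the past *)

Section Independence.
Local Open Scope ereal_scope.

Lemma product_measure_section_ge {R : realType} {d1 d2 : measure_display}
    {T1 : measurableType d1} {T2 : measurableType d2}
    (m1 : probability T1 R) (m2 : probability T2 R) (E : set (T1 * T2)) (q : R) :
  measurable E -> (0 <= q)%R ->
  (forall t, q%:E <= m2 (xsection E t)) -> q%:E <= (m1 \x m2) E.
Proof.
move=> mE q0 qE.
have <- : \int[m1]_t (cst q%:E t) = q%:E.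
  by rewrite integral_cst// -[RHS]mule1; congr (_ * _); exact: probability_setT.
have mf2 := @measurable_fun_xsection _ _ _ _ _ m2 _ mE.
by apply: ge0_le_integral => //; move=> t _; exact: qE.

Qed.

(** The joint law of [Y] and [Z] is the product of their laws, because it agrees
with it on rectangles; a bound on all sections then integrates. *)
Lemma independent_section_ge {R : realType} {dO dS dT : measure_display}
    {Omega : measurableType dO} {S : measurableType dS} {T : measurableType dT}
    (P : probability Omega R) (mu : probability T R)
    (Y : Omega -> S) (Z : Omega -> T) (E : set (S * T)) (q : R) :
  measurable_fun setT Y -> measurable_fun setT Z ->
  (forall A B, measurable A -> measurable B ->
    P (Y @^-1` A `&` Z @^-1` B) = P (Y @^-1` A) * mu B) ->
  measurable E -> (0 <= q)%R ->
  (forall s, q%:E <= mu (xsection E s)) ->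
  q%:E <= P [set w | E (Y w, Z w)].
Proof.
move=> mY mZ indep mE q0 qE.
have mYZ : measurable_fun setT (fun w => (Y w, Z w)) by exact: measurable_fun_pair.
pose Yf : {mfun Omega >-> S} := mfun_Sub (mem_set mY).
pose YZf : {mfun Omega >-> (S * T)%type} := mfun_Sub (mem_set mYZ).
have -> : P [set w | E (Y w, Z w)] = distribution P YZf E by [].
rewrite -(@product_measure_unique _ _ _ _ _ (distribution P Yf) mu)//.
exact: product_measure_section_ge.
Qed.

Section Past.
Context {R : realType} {dO dT : measure_display} {Omega : measurableType dO}
  {T : measurableType dT} (P : probability Omega R) (X : nat -> Omega -> T).
Hypothesis X_measurable : forall k, measurable_fun setT (X k).
Hypothesis X_indep : mutually_independent P X.

(** The events described by the first [k] draws separately.  They form a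
pi-system, on which independence of the next draw is the product rule. *)
Definition past_rectangles (k : nat) : set (set Omega) :=
  [set A | exists B : 'I_k -> set T, (forall i, measurable (B i)) /\
     A = [set w | forall i, B i (X i w)]].

Lemma past_rectangles_measurable k : past_rectangles k `<=` measurable.
Proof.
move=> _ [B [mB ->]].
rewrite (_ : [set w | _] = \bigcap_(i : 'I_k) (X i @^-1` B i)).
  apply: fin_bigcap_measurable => // i _.
  by rewrite -[X in measurable X]setTI; exact: X_measurable.
by apply/seteqP; split=> w /= h i => [_|]; [exact: h|exact: (h i)].
Qed.

Lemma past_rectangles_setI k : setI_closed (past_rectangles k).
Proof.
move=> _ _ [B [mB ->]] [C [mC ->]]; exists (fun i => B i `&` C i); split.
  by move=> i; exact: measurableI.
apply/seteqP; split=> w /=; first by move=> [h1 h2] i; split.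
by move=> h; split=> i; have [] := h i.
Qed.

Lemma past_rectangles_setT k : past_rectangles k setT.
Proof. by exists (fun=> setT); split=> //; apply/seteqP; split. Qed.

(** [Omega] with the sigma-algebra of the first [k] draws. *)
Definition past_type k := g_sigma_algebraType (past_rectangles k).

Lemma measurable_past_coord k i : (i < k)%N ->
  measurable_fun [set: past_type k] (X i : past_type k -> T).
Proof.
move=> ik _ B mB; rewrite setTI; apply: sub_sigma_algebra.
exists (fun j : 'I_k => if j == i :> nat then B else setT); split.
  by move=> j; case: ifP.
apply/seteqP; split=> w /= h => [j|]; first by case: eqP => // ->.
by have := h (Ordinal ik); rewrite /= eqxx.
Qed.

Lemma measurable_past k (A : set Omega) :
  measurable (A : set (past_type k)) -> measurable A.
Proof.
move=> mA; apply: (@smallest_sub _ _ (past_rectangles k) measurable) A mA.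
  exact: sigma_algebra_measurable.
exact: past_rectangles_measurable.
Qed.

(** Both sides are finite measures in [A] that agree on the pi-system of past
rectangles. *)
Lemma past_indep k (A : set Omega) B :
  measurable (A : set (past_type k)) -> measurable B ->
  P (A `&` X k @^-1` B) = P A * P (X k @^-1` B).
Proof.
move=> mA mB.
have mXB : measurable (X k @^-1` B).
  by rewrite -[X in measurable X]setTI; exact: X_measurable.
have c0 : (0 <= fine (P (X k @^-1` B)))%R by exact: fine_ge0.
rewrite muleC -[P (X k @^-1` B)]fineK ?fin_num_measure//.
have := @g_sigma_algebra_measure_unique _ R Omega _ (@past_rectangles_measurable k)
  (fun=> setT) (fun=> past_rectangles_setT k) _
  (mrestr P mXB) (mscale (NngNum c0) P) (@past_rectangles_setI k) _ _ A mA.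
apply.
- by rewrite bigcup_const.
- move=> _ [C [mC ->]].
  rewrite /= /mrestr /mscale /= fineK ?fin_num_measure//.
  pose C' (i : 'I_k.+1) : set T := if unlift ord_max i is Some j then C j else B.
  have mC' i : measurable (C' i) by rewrite /C'; case: unliftP.
  rewrite (X_indep mC).
  have <- : [set w | forall i, C' i (X i w)] =
     [set w | forall i, C i (X i w)] `&` (X k @^-1` B).
    apply/seteqP; split=> w /=.
      move=> h; split=> [i|].
        by have := h (lift ord_max i); rewrite /C' liftK lift_max.
      by have := h ord_max; rewrite /C' unlift_none.
    by move=> [h1 h2] i; rewrite /C'; case: unliftP => [j ->|->//]; rewrite lift_max.
  rewrite (X_indep mC') big_ord_recr/= muleC; congr (_ * _).
    by rewrite /C' unlift_none.
  apply: eq_bigr => i _; congr (P (X _ @^-1` _)).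
  rewrite /C' (_ : widen_ord _ i = lift ord_max i) ?liftK//.
  by apply/val_inj/esym/lift_max.
- move=> _ /=; rewrite /mrestr setTI.
  by rewrite (le_lt_trans (probability_le1 P mXB))// ltry.
Qed.

(** The iterate at which a draw is used is itself random, but it is a function of
the past.  A guarantee on one draw that holds at every fixed point therefore
holds, with the same probability, at the random iterate. *)
Lemma prob_ge_past_present k (mu : probability T R) (E : set (past_type k * T)) q :
  (forall B, measurable B -> P (X k @^-1` B) = mu B) ->
  measurable E -> (0 <= q)%R -> (forall s, q%:E <= mu (xsection E s)) ->
  q%:E <= P [set w | E (w, X k w)].
Proof.
move=> law mE q0 qE.
apply: (@independent_section_ge _ _ _ _ Omega (past_type k) T P mu id (X k)) => //.
- by move=> _ A mA; rewrite setTI; exact: (@measurable_past k).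
- by move=> A B mA mB; rewrite (past_indep mA mB) law.
Qed.

End Past.

End Independence.

(** * Running time *)

(** Because [1 + 2 / e <= (1 + 1 / e) ^ 2]: the accuracy passed to the
eigenvector routine, half of a quantity at least [e], at most doubles the
logarithm. *)
Lemma ln1D_half_le {R : realType} (M e : R) : 0 < e -> e <= M ->
  ln (1 + (M / 2)^-1) <= 2 * ln (1 + e^-1).
Proof.
move=> e0 eM; have M0 : 0 < M by exact: lt_le_trans eM.
have ie : 0 < e^-1 by rewrite invr_gt0.
rewrite mulr_natl -lnXn ?addr_gt0// ler_ln ?posrE ?exprn_gt0 ?addr_gt0//;
  last by rewrite invr_gt0 divr_gt0.
have : M^-1 <= e^-1 by rewrite lef_pV2.
rewrite invf_div sqrrD expr1n mul1r mulr2n; have := sqr_ge0 e^-1; lra.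
Qed.

(** In the constant, [2 ^+ k] is the effect of the halved accuracy on the [k]-th
power of the logarithmic factor, [2] bounds the [sqrt 2] that it brings into
the square root, and [1] accounts for the gradients and for the last product. *)
Lemma iteration_time_le {R : realType} (C0 m1 m2 Tg Th L1 M e1 e2 t p : R)
    (d k : nat) :
  (0 < d)%N -> 0 < p < 1 -> 0 < e1 -> 0 < e2 -> e2 <= M -> 0 < L1 -> 0 < Th ->
  0 <= m1 -> 0 <= m2 -> 0 < Tg ->
  t <= C0 * log_factor d p [:: M / 2] ^+ k *
     (Th * Num.max m2 (m2 `^ (3 / 4) * Num.sqrt (L1 / (M / 2)))) ->
  m1 * Tg + t + m2 * Th <=
  (`|C0| * 2 ^+ k * 2 + 1) * log_factor d p [:: e1; e2] ^+ k *
  (Th * m2 + Th * m2 `^ (3 / 4) * (Num.sqrt L1 / M `^ (1 / 2)) + m1 * Tg).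
Proof.
move=> d0 /andP[p0 p1] e10 e20 eM L10 Th0 m10 m20 Tg0.
have M0 : 0 < M by exact: lt_le_trans eM.
set lf := log_factor _ _ [:: M / 2]; set LF := log_factor _ _ _.
have ln1 (e : R) : 0 < e -> 0 <= ln (1 + e^-1).
  by move=> e0; rewrite ln_ge0// lerDl invr_ge0 ltW.
have lnd : 0 <= ln d%:R :> R by rewrite ln_ge0// ler1n.
have lnp : 0 <= ln p^-1 by rewrite ln_ge0// invf_ge1// ltW.
have lfE : lf = 1 + ln d%:R + ln p^-1 + ln (1 + (M / 2)^-1).
  by rewrite /lf /log_factor big_seq1.
have LFE : LF = 1 + ln d%:R + ln p^-1 + (ln (1 + e1^-1) + ln (1 + e2^-1)).
  by rewrite /LF /log_factor big_cons big_seq1.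
have LF1 : 1 <= LF by rewrite LFE; have := ln1 _ e10; have := ln1 _ e20; lra.
have lf0 : 0 <= lf.
  by rewrite lfE; have := ln1 _ (_ : 0 < M / 2); rewrite divr_gt0// => /(_ isT); lra.
have lfLF : lf <= 2 * LF.
  rewrite lfE LFE; have := ln1D_half_le e20 eM; have := ln1 _ e10; lra.
have -> : M `^ (1 / 2) = Num.sqrt M by rewrite mul1r powR12_sqrt// ltW.
set a := m2 `^ (3 / 4); have a0 : 0 <= a by exact: powR_ge0.
set r := Num.sqrt L1 / Num.sqrt M.
have r0 : 0 <= r by rewrite divr_ge0 ?sqrtr_ge0.
have sr : Num.sqrt (L1 / (M / 2)) <= 2 * r.
  rewrite /r (_ : L1 / (M / 2) = 2 * (L1 * M^-1)); last by field; rewrite gt_eqF.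
  rewrite !sqrtrM ?(ltW L10)// sqrtrV ?(ltW M0)// ler_wpM2r//.
  have s2 : Num.sqrt 2 ^+ 2 = 2 :> R by rewrite sqr_sqrtr.
  have := sqrtr_ge0 (2 : R); nra.
set B := _ + _ + m1 * Tg.
have B0 : 0 <= B by rewrite /B !addr_ge0 ?mulr_ge0 ?(ltW Th0) ?(ltW Tg0).
have maxB : Th * Num.max m2 (a * Num.sqrt (L1 / (M / 2))) <= 2 * B.
  have asr : a * Num.sqrt (L1 / (M / 2)) <= 2 * (a * r).
    by rewrite mulrCA ler_wpM2l.
  have mx : Num.max m2 (a * Num.sqrt (L1 / (M / 2))) <= 2 * m2 + 2 * (a * r).
    have := mulr_ge0 a0 r0; rewrite ge_max => ar; apply/andP; split; lra.
  have := ler_wpM2l (ltW Th0) mx; have := mulr_ge0 m10 (ltW Tg0).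
  rewrite /B -/r; lra.
have X0 : 0 <= Th * Num.max m2 (a * Num.sqrt (L1 / (M / 2))).
  by rewrite mulr_ge0 ?(ltW Th0)// le_max m20.
move=> tle.
have lfk : lf ^+ k <= 2 ^+ k * LF ^+ k.
  by rewrite -exprMn lerXn2r ?nnegrE// mulr_ge0// (le_trans ler01).
have t2 : t <= `|C0| * (2 ^+ k * LF ^+ k) * (2 * B).
  apply: (le_trans tle).
  apply: (@le_trans _ _ (`|C0| * lf ^+ k *
      (Th * Num.max m2 (a * Num.sqrt (L1 / (M / 2)))))).
    by rewrite ler_wpM2r// ler_wpM2r ?exprn_ge0// ler_norm.
  apply: ler_pM => //; first by rewrite mulr_ge0 ?exprn_ge0.
  by rewrite ler_wpM2l.
have LFk : B <= LF ^+ k * B by rewrite ler_peMl// exprn_ege1.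
have : m1 * Tg + m2 * Th <= B.
  have := mulr_ge0 (mulr_ge0 (ltW Th0) a0) r0; rewrite /B; lra.
lra.
Qed.

(** * Union bounds *)

Section Events.
Local Open Scope ereal_scope.
Context {R : realType} {dO : measure_display} {Omega : measurableType dO}
  (P : probability Omega R).

Lemma prob_setI_ge (A B : set Omega) (a b : R) : measurable A -> measurable B ->
  (1 - a)%:E <= P A -> (1 - b)%:E <= P B -> (1 - (a + b))%:E <= P (A `&` B).
Proof.
move=> mA mB PA PB.
have fin C : measurable C -> P C = (fine (P C))%:E.
  by move=> mC; rewrite fineK ?fin_num_measure.
have mAB := measurableI _ _ mA mB.
have mD : measurable (A `\` B) by exact: measurableD.
have eA : P A = P (A `\` B) + P (A `&` B) := measureDI P mA mB.
have : P (A `\` B) <= P (~` B).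
  by apply: le_measure => [||w []]; rewrite ?inE//; exact: measurableC.
rewrite probability_setC//; move: PA PB eA.
rewrite (fin _ mA) (fin _ mB) (fin _ mD) (fin _ mAB).
rewrite -[1]/(1%:E) -EFinB -EFinD !lee_fin => h1 h2 [h3] h4; lra.
Qed.

Lemma prob_bigcap_ge (A : nat -> set Omega) (a : R) K :
  (forall k, measurable (A k)) -> (forall k, (1 - a)%:E <= P (A k)) ->
  measurable [set w | forall k, (k < K)%N -> A k w] /\
  (1 - K%:R * a)%:E <= P [set w | forall k, (k < K)%N -> A k w].
Proof.
move=> mA PA; elim: K => [|K [mK PK]].
  have -> : [set w | forall k, (k < 0)%N -> A k w] = setT by apply/seteqP; split.
  by rewrite mul0r subr0 probability_setT.
have -> : [set w | forall k, (k < K.+1)%N -> A k w] =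
    [set w | forall k, (k < K)%N -> A k w] `&` A K.
  apply/seteqP; split=> w /= => [h|[h1 h2] k].
    by split=> [k kK|]; apply: h => //; exact: ltnW.
  by rewrite ltnS leq_eqVlt => /predU1P[->//|]; exact: h1.
split; first exact: measurableI.
by rewrite -natr1 mulrDl mul1r; exact: prob_setI_ge.
Qed.

End Events.

(** * Sampling and eigenvector events along a run *)

Section RunEvents.
Context {R : realType} {A : approx_pca R} {d : nat} {dX : measure_display}
  {Xi : measurableType dX} (F : Xi -> 'rV[R]_d -> R) (f : 'rV[R]_d -> R)
  {m1 m2 : nat} (nu : probability (sample Xi m1 m2) R)
  (L1 L2 eps1 alpha p : R) (x0 : 'rV[R]_d).
Hypotheses (d_gt0 : (0 < d)%N) (m2_gt0 : (0 < m2)%N) (L1_gt0 : 0 < L1)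
  (L2_gt0 : 0 < L2) (eps1_gt0 : 0 < eps1) (p_range : 0 < p < 1).
Hypothesis F_smooth : forall xi, smooth_component L1 L2 (F xi).
Hypothesis f_smooth : smooth_component L1 L2 f.
Hypothesis F_measurable : forall x, measurable_fun setT (F ^~ x).
Let eps2 := sncg_eps2 eps1 alpha.
Hypothesis sampling : forall x, sampling_accurate F f L2 eps1 eps2 nu p x.
Context {dO : measure_display} {Omega : measurableType dO}
  (P : probability Omega R) (X : nat -> Omega -> draw A Xi m1 m2).
Hypothesis X_fresh : fresh_draws nu P X.

Let x w k := sncg_iterate F L1 L2 eps1 alpha p x0 (X ^~ w) k.

Definition sampling_event k : set Omega :=
  [set w | accurate_sample F f L2 eps1 eps2 (x w k) (X k w).1.1 (X k w).1.2].

Definition pca_event k : set Omega :=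
  [set w | quad (sub_hess F (X k w).1.2 (x w k))
             (sncg_step F L1 L2 eps1 alpha p (x w k) (X k w)).2
           - sncg_pca_accuracy F eps1 alpha (x w k) (X k w)
           <= lambda_min (sub_hess F (X k w).1.2 (x w k))].

Let X_measurable : forall k, measurable_fun setT (X k).
Proof. by case: X_fresh. Qed.

Let X_law k B : measurable B -> P (X k @^-1` B) = (nu \x pca_law A)%E B.
Proof. by case: X_fresh => _ + _; apply. Qed.

Let X_indep : mutually_independent P X.
Proof. by case: X_fresh. Qed.

Let L1_ge0 : 0 <= L1 := ltW L1_gt0.
Let L2_ge0 : 0 <= L2 := ltW L2_gt0.
Let eps2_pos : 0 < eps2 := eps2_gt0 alpha eps1_gt0.

Let p1_ge0 : 0 <= 1 - p.
Proof. by rewrite subr_ge0; case/andP: p_range => _ /ltW. Qed.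

Lemma measurable_iterate_Omega k : measurable_row (x ^~ k).
Proof.
apply: (measurable_iterate _ _ _ _ L1_ge0 L2_ge0 F_smooth F_measurable
  (draws := fun w i => X i w)) => i _; exact: X_measurable.
Qed.

Lemma measurable_sampling_event k : measurable (sampling_event k).
Proof.
apply: (measurable_accurate_sample _ L1_ge0 L2_ge0 F_smooth f_smooth F_measurable) => //.
  exact: measurable_iterate_Omega.
exact: ltW.
Qed.

Lemma measurable_pca_event k : measurable (pca_event k).
Proof.
apply: (measurable_pca_accurate _ _ _ L1_ge0 L2_ge0 F_smooth F_measurable) => //.
exact: measurable_iterate_Omega.
Qed.

Let measurable_past_iterate k : measurable_row
  (fun z : past_type X k * draw A Xi m1 m2 => x z.1 k).
Proof.
apply: (measurable_iterate _ _ _ _ L1_ge0 L2_ge0 F_smooth F_measurable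
  (draws := fun (z : past_type X k * draw A Xi m1 m2) i => X i z.1)) => i ik.
have mXi : measurable_fun [set: past_type X k] (X i : past_type X k -> _).
  exact: measurable_past_coord.
exact: (measurableT_comp mXi measurable_fst).
Qed.

Lemma prob_sampling_event k : ((1 - p)%:E <= P (sampling_event k))%E.
Proof.
pose E := [set z : past_type X k * draw A Xi m1 m2 |
  accurate_sample F f L2 eps1 eps2 (x z.1 k) z.2.1.1 z.2.1.2].
have mE : measurable E.
  exact: (measurable_accurate_sample _ L1_ge0 L2_ge0 F_smooth f_smooth
    F_measurable (@measurable_past_iterate k) measurable_snd (ltW eps2_pos)).
apply: (prob_ge_past_present X_measurable X_indep (@X_law k) mE p1_ge0) => s.
have [e3 [e4 [e3le e4le [B [mB BE PB]]]]] := sampling (x s k).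
have nuB : nu B = (nu \x pca_law A)%E (B `*` setT).
  rewrite product_measure1E// -[LHS]mule1; congr (_ * _)%E.
  exact/esym/probability_setT.
rewrite (le_trans PB)// nuB; apply: le_measure; rewrite ?inE.
- exact: measurableX.
- exact: measurable_xsection.
move=> [S z] [/= /BE[HS gS] _]; rewrite /xsection/= inE; split=> /=.
  exact: le_trans e3le.
exact: le_trans e4le.
Qed.

(** At a fixed iterate, the guarantee of the eigenvector routine holds for each
value of the samples, hence on average over them. *)
Lemma prob_pca_event k : ((1 - p)%:E <= P (pca_event k))%E.
Proof.
pose E := [set z : past_type X k * draw A Xi m1 m2 |
  quad (sub_hess F z.2.1.2 (x z.1 k))
     (sncg_step F L1 L2 eps1 alpha p (x z.1 k) z.2).2
   - sncg_pca_accuracy F eps1 alpha (x z.1 k) z.2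
   <= lambda_min (sub_hess F z.2.1.2 (x z.1 k))].
have mE : measurable E.
  exact: (measurable_pca_accurate _ _ _ L1_ge0 L2_ge0 F_smooth F_measurable
    (@measurable_past_iterate k) measurable_snd d_gt0).
apply: (prob_ge_past_present X_measurable X_indep (@X_law k) mE p1_ge0) => s.
have mEs : measurable (xsection E s) by exact: measurable_xsection.
apply: product_measure_section_ge => // S.
have acc0 := sncg_pca_accuracy_gt0 F alpha eps1_gt0 (x s k) (S, point : pca_seed A).
have inp : pca_input L1 (sample_hess F S.2 (x s k))
    (sncg_pca_accuracy F eps1 alpha (x s k) (S, point : pca_seed A)) p.
  exact: (pca_input_sample _ _ d_gt0 m2_gt0 L1_gt0 L2_gt0).
have [B [mB BE PB]] := pca_accurate A inp.
apply: (le_trans PB); apply: le_measure; rewrite ?inE//.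
  exact: measurable_xsection.
move=> z /BE /= h; rewrite /xsection/= inE/= inE /E/=.
by move: h; rewrite lerBlDl -lerBlDr.
Qed.

End RunEvents.

(** * Termination, guarantees and cost of the stochastic algorithm *)

Theorem theorem10 (R : realType) (A : approx_pca R) :
  exists (C : R) (q : nat),
  forall (d : nat) (d_gt0 : (0 < d)%N)
    (dX : measure_display) (Xi : measurableType dX)
    (F : Xi -> 'rV[R]_d -> R) (f : 'rV[R]_d -> R)
    (m1 m2 : R -> nat)
    (nu : forall p : R, probability (sample Xi (m1 p) (m2 p)) R)
    (m1_gt0 : forall p, (0 < m1 p)%N) (m2_gt0 : forall p, (0 < m2 p)%N)
    (f_def : stochastic_objective F f nu)
    (L1 L2 : R) (L1_gt0 : 0 < L1) (L2_gt0 : 0 < L2)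
    (F_smooth : forall xi, smooth_component L1 L2 (F xi))
    (xstar : 'rV[R]_d) (xstar_min : forall x, f xstar <= f x)
    (x0 : 'rV[R]_d) (Delta : R) (x0_gap : f x0 - f xstar <= Delta)
    (delta : R) (delta_range : 0 < delta < 1)
    (eps1 alpha : R) (eps1_gt0 : 0 < eps1) (alpha_range : 0 < alpha <= 1),
  let eps2 := eps1 `^ alpha in
  forall (sampling : forall (p : R) (x : 'rV[R]_d), 0 < p < 1 ->
      sampling_accurate F f L2 eps1 eps2 (nu p) p x),
  let N := 1 + sncg_rate L1 L2 eps1 eps2 * Delta in
  let p := sncg_step_failure L1 L2 eps1 eps2 Delta delta in
  forall (dO : measure_display) (Omega : measurableType dO)
    (P : probability Omega R)
    (X : nat -> Omega -> draw A Xi (m1 p) (m2 p))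
    (X_fresh : fresh_draws (nu p) P X),
  let draws w k := X k w in
  let x w k := sncg_iterate F L1 L2 eps1 alpha p x0 (draws w) k in
  let terminates w k :=
    sncg_terminates_at F L1 L2 eps1 alpha p x0 (draws w) k in
  [/\ with_prob_ge P (1 - delta)
        [set w | exists k, terminates w k /\ k.+1%:R <= N],
      with_prob_ge P (1 - 3 * delta)
        [set w | exists k, [/\ terminates w k, k.+1%:R <= N,
           norm2 (grad f (x w k)) <= 2 * eps1 &
           lambda_min (hess f (x w k)) >= - (2 * eps2)]] &
      forall (Tg Th : R) (Tg_gt0 : 0 < Tg) (Th_gt0 : 0 < Th) w k,
        sncg_iteration_time F L1 L2 eps1 alpha p x0 Tg Th (draws w) k <=
        C * log_factor d p [:: eps1; eps2] ^+ q *
        (Th * (m2 p)%:R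
         + Th * (m2 p)%:R `^ (3 / 4)
           * (Num.sqrt L1 /
              (Num.max eps2
                 (norm2 (sub_grad F (X k w).1.1 (x w k)) `^ alpha)) `^ (1 / 2))
         + (m1 p)%:R * Tg)].
Proof.
have [C0 [k0 fast]] := pca_fast A.
exists (`|C0| * 2 ^+ k0 * 2 + 1), k0 => d d_gt0 dX Xi F f m1 m2 nu m1_gt0 m2_gt0
  f_def L1 L2 L1_gt0 L2_gt0 F_smooth xstar xstar_min x0 Delta x0_gap delta
  /andP[delta0 delta1] eps1 alpha eps1_gt0 alpha_range eps2 sampling N p dO Omega P
  X X_fresh draws x terminates.
have f_smooth := smooth_objective f_def (ltW L1_gt0) (ltW L2_gt0) F_smooth.
have F_meas := measurable_component f_def.
have Delta0 : 0 <= Delta by rewrite (le_trans _ x0_gap)// subr_ge0.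
have rate0 := sncg_rate_gt0 L1 alpha L2_gt0 eps1_gt0.
have N1 : 1 <= N by rewrite lerDl mulr_ge0// ltW.
have N0 : 0 < N by exact: lt_le_trans N1.
have pE : p * N = delta by rewrite /p /sncg_step_failure divfK// gt_eqF.
have p0 : 0 < p by rewrite divr_gt0.
have p1 : p < 1 by rewrite (le_lt_trans _ delta1)// -pE ler_peMr// ltW.
have p_range : 0 < p < 1 by rewrite p0.
have samp y := sampling p y p_range.
(* The number of iterations that the bound j <= N allows. *)
pose K := Num.truncn N.
have /andP[KN NK] : K%:R <= N < K.+1%:R by exact/truncn_itv/ltW.
have Kp : K%:R * p <= delta by rewrite -pE mulrC ler_wpM2l// ltW.
have rateK : sncg_rate L1 L2 eps1 eps2 * Delta < K%:R.
  by move: NK; rewrite -natr1 /N addrC ltrD2r.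
pose SE := sampling_event (A := A) F f L1 L2 eps1 alpha p x0 X.
pose PE := pca_event (A := A) F L1 L2 eps1 alpha p x0 X.
have mSE k : measurable (SE k).
  exact: (measurable_sampling_event _ _ x0 L1_gt0 L2_gt0 eps1_gt0
    F_smooth f_smooth F_meas X_fresh).
have mPE k : measurable (PE k).
  exact: (measurable_pca_event _ _ _ x0 d_gt0 L1_gt0 L2_gt0 F_smooth F_meas X_fresh).
have PSE k : ((1 - p)%:E <= P (SE k))%E.
  exact: (prob_sampling_event x0 L1_gt0 L2_gt0 eps1_gt0 p_range
    F_smooth f_smooth F_meas samp X_fresh).
have PPE k : ((1 - p)%:E <= P (PE k))%E.
  exact: (prob_pca_event _ x0 d_gt0 (m2_gt0 p) L1_gt0 L2_gt0 eps1_gt0 p_range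
    F_smooth F_meas X_fresh).
have [mS PS] := prob_bigcap_ge K mSE PSE.
have [mP PP] := prob_bigcap_ge K mPE PPE.
have termin w : (forall k, (k < K)%N -> SE k w) ->
    exists2 k, (k < K)%N & terminates w k.
  move=> acc.
  exact: (terminates_within d_gt0 (m2_gt0 p) L1_gt0 L2_gt0 eps1_gt0 p_range
    F_smooth f_smooth xstar_min x0_gap acc rateK).
have kN k : (k < K)%N -> k.+1%:R <= N.
  by move=> kK; rewrite (le_trans _ KN)// ler_nat.
split.
- exists [set w | forall k, (k < K)%N -> SE k w]; split => //.
    by move=> w /termin[k kK tk]; exists k; split => //; exact: kN.
  by rewrite (le_trans _ PS)// lee_fin lerD2l lerN2.
- exists ([set w | forall k, (k < K)%N -> SE k w] `&`
          [set w | forall k, (k < K)%N -> PE k w]); split.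
  + exact: measurableI.
  + move=> w [accS accP]; have [k kK tk] := termin w accS.
    have [] := termination_guarantee d_gt0 L2_gt0 eps1_gt0 F_smooth f_smooth
      (accS k kK) (accP k kK) alpha_range tk.1.
    by move=> hg hl; exists k; split => //; exact: kN.
  + rewrite (le_trans _ (prob_setI_ge mS mP PS PP))// lee_fin; lra.
- move=> Tg Th Tg0 Th0 w k.
  have M_ge : eps2 <= Num.max eps2 (norm2 (sub_grad F (X k w).1.1 (x w k)) `^ alpha).
    by rewrite le_max lexx.
  apply: (iteration_time_le d_gt0 p_range eps1_gt0 (eps2_gt0 alpha eps1_gt0) M_ge
    L1_gt0 Th0 (ler0n R (m1 p)) (ler0n R (m2 p)) Tg0).
  apply: fast => //; apply: (pca_input_sample _ _ d_gt0 (m2_gt0 p) L1_gt0 L2_gt0) => //.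
  exact: sncg_pca_accuracy_gt0.
Qed.
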